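(* Let $\mathbb{K}$ be a field. With the filtrations $PS_k, PS^{(k)}, PS(k)$ of $\mathrm{ParSym}$ and $PQ_k, PQ^{(k)}, PQ(k)$ of $\mathrm{ParQSym}$ ($k\ge0$) defined in the context: (a) $\{PS_k\}$ and $\{PS^{(k)}\}$ are Hopf filtrations of $\mathrm{ParSym}$; (b) $\{PQ_k\}$, $\{PQ(k)\}$ and $\{PQ^{(k)}\}$ are Hopf filtrations of $\mathrm{ParQSym}$; (c) $\{PS(k)\}$ is an algebra filtration of $\mathrm{ParSym}$ but not a coalgebra filtration; (d) $\{PQ(k)\}$ is the coradical filtration of $\mathrm{ParQSym}$.
   Context: **Partition diagrams.** A partition diagram of order $k\ge 0$ is a set partition of $\{1,\dots,k,1',\dots,k'\}$; for $k=0$ the only one is the empty diagram $\emptyset$. For $\pi$ of order $k$ and $\rho$ of order $m$, $\pi\otimes\rho$ is the diagram of order $k+m$ whose blocks are the blocks of $\pi$ and the blocks of $\rho$ with labels shifted by $k$ ($i\mapsto i+k$, $i'\mapsto (i+k)'$). If $k,m\ge1$, $\pi\bullet\rho$ is obtained from $\pi\otimes\rho$ by merging the block containing $k'$ with the block containing $(k+1)'$. The empty diagram is the unit for both operations. A diagram is $\otimes$-irreducible (resp. $\bullet$-irreducible) if it is not $\rho\otimes\sigma$ (resp. $\rho\bullet\sigma$) with $\rho,\sigma$ both non-empty (so $\emptyset$ is both). Every non-empty $\pi$ is uniquely $\pi_1\otimes\cdots\otimes\pi_l$ with all $\pi_i$ non-empty and $\otimes$-irreducible; $l(\pi):=l$,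 and $l(\emptyset):=0$. Every non-empty $\pi$ can be uniquely written $\pi=\pi_1\divideontimes_1\cdots\divideontimes_{n-1}\pi_n$ with each $\divideontimes_i\in\{\otimes,\bullet\}$ and each $\pi_i$ non-empty and both $\otimes$- and $\bullet$-irreducible (on non-empty diagrams $\otimes$ and $\bullet$ associate with each other). Let $I_n$ ($n\ge1$) be the set of diagrams with exactly $n$ such factors, $I_0=\{\emptyset\}$. Let $P(n)=\{\pi: l(\pi)=n\}$ and $A_n$ the set of diagrams of order $n$. **ParSym** has $\mathbb{K}$-basis $\{H_\pi\}$ over all diagrams, product $H_\pi H_\rho=H_{\pi\otimes\rho}$, unit $H_\emptyset$, counit $H_\pi\mapsto\delta_{\pi,\emptyset}$, and coproduct the algebra map $\Delta$ with $\Delta H_\sigma=\sum H_\pi\otimes H_\rho$ for $\otimes$-irreducible $\sigma$, over all pairs of $\otimes$-irreducible (possibly empty) $\pi,\rho$ with $\pi\bullet\rho=\sigma$. It is a Hopf algebra, connected graded by order. **ParQSym** has $\mathbb{K}$-basis $\{M_\pi\}$ over all diagrams, coproduct $\Delta M_\sigma=\sum_{\pi\otimes\rho=\sigma}M_\pi\otimes M_\rho$, counit $\varepsilon(M_\pi)=\delta_{\pi,\emptyset}$, unit $M_\emptyset$, and for non-empty $\rho=\rho_1\otimes\cdots\otimes\rho_n$, $\sigma=\sigma_1\otimes\cdots\otimes\sigma_m$ with all $\rho_i,\sigma_j$ non-empty $\otimes$-irreducible, $M_\rho\star M_\sigma=\sum M_{(\rho'_1\bullet\sigma'_1)\otimes\cdots\otimes(\rho'_k\bullet\sigma'_k)}$,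 over all $k\in\mathbb{N}$ and all pairs of sequences of diagrams $(\rho'_1,\dots,\rho'_k)$, $(\sigma'_1,\dots,\sigma'_k)$ that become $(\rho_1,\dots,\rho_n)$, respectively $(\sigma_1,\dots,\sigma_m)$, after deleting all empty diagrams, with $\rho'_s\bullet\sigma'_s\ne\emptyset$ for all $s$. It is a Hopf algebra, connected graded by order. **Filtrations.** $PS_k$, $PS^{(k)}$, $PS(k)$ are the spans of the $H_\pi$ with $\pi\in\bigcup_{i\le k}A_i$, $\pi\in\bigcup_{i\le k}I_i$, $\pi\in\bigcup_{i\le k}P(i)$, respectively; $PQ_k$, $PQ^{(k)}$, $PQ(k)$ are the spans of the $M_\pi$ for the same three index sets. For a Hopf algebra $H$ with antipode $S$ and an increasing sequence of subspaces $V_0\subseteq V_1\subseteq\cdots$ with $\bigcup_n V_n=H$: it is a coalgebra filtration if $\Delta V_n\subseteq\sum_{i=0}^n V_i\otimes V_{n-i}$ for all $n$; an algebra filtration if $V_nV_m\subseteq V_{n+m}$ for all $n,m$; a Hopf (algebra) filtration if it is both and $S(V_n)\subseteq V_n$ for all $n$. The coradical filtration of a coalgebra $C$ is defined by $C_0=$ the coradical (sum of all simple subcoalgebras) and $C_n=\Delta^{-1}(C\otimes C_{n-1}+C_0\otimes C)$ for $n\ge1$. *)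

(* Defs.v *)
(* MathComp, with the free modules {malg K[B]} of multinomials. *)
From HB Require Import structures.
From mathcomp Require Import all_boot all_order all_algebra.
From mathcomp Require Import finmap.
From mathcomp Require Import monalg.

Set Implicit Arguments.
Unset Strict Implicit.
Unset Printing Implicit Defensive.

Import GRing.Theory.

(* (i, false) encodes the label i+1 and (i, true) the label (i+1)'. *)
Definition label (k : nat) : finType := ('I_k * bool)%type.

Definition diagram_of (k : nat) : finType :=
  {P : {set {set label k}} | partition P [set: label k]}.

Definition diagram : Type := {k : nat & diagram_of k}.

HB.instance Definition _ := Choice.copy diagram {k : nat & diagram_of k}.

Definition order (p : diagram) : nat := tag p.

Definition mkdiagram (k : nat) (P : {set {set label k}})
    (hP : partition P [set: label k]) : diagram :=
  Tagged diagram_of (exist _ P hP : diagram_of k).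

Lemma partition_dempty : partition set0 [set: label 0].
Proof.
have -> : [set: label 0] = set0 by apply/setP => -[[]].
by rewrite partition_set0.
Qed.

Definition dempty : diagram := mkdiagram partition_dempty.

Definition lsh (k m : nat) (x : label k) : label (k + m) := (lshift m x.1, x.2).
Definition rsh (k m : nat) (x : label m) : label (k + m) := (rshift k x.1, x.2).

Definition tens_blocks (k m : nat) (P : {set {set label k}})
    (Q : {set {set label m}}) : {set {set label (k + m)}} :=
  [set lsh m @: (B : {set label k}) | B in P] :|:
  [set @rsh k m @: (B : {set label m}) | B in Q].

Lemma lsh_inj k m : injective (@lsh k m).
Proof. by move=> [i b] [j c] [/= /val_inj -> ->]. Qed.

Lemma rsh_inj k m : injective (@rsh k m).
Proof. by move=> [i b] [j c] [/= /addnI/val_inj -> ->]. Qed.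

Lemma partition_tens k m P Q :
  partition P [set: label k] -> partition Q [set: label m] ->
  partition (@tens_blocks k m P Q) [set: label (k + m)].
Proof.
move=> hP hQ.
have hP' := hP; have hQ' := hQ.
rewrite -(imset_partition _ _ (@lsh_inj k m)) in hP'.
rewrite -(imset_partition _ _ (@rsh_inj k m)) in hQ'.
have dj : [disjoint (@lsh k m @: [set: label k]) & (@rsh k m @: [set: label m])].
  rewrite -setI_eq0; apply/eqP/setP => x; rewrite !inE.
  apply/negP => /andP[/imsetP[[i b] _ ->] /imsetP[[j c] _ [e _]]].
  by move: (ltn_ord i); rewrite e ltnNge leq_addr.
have un : [set: label (k + m)] =
    (@lsh k m @: [set: label k]) :|: (@rsh k m @: [set: label m]).
  apply/setP => -[i b]; rewrite !inE; symmetry; apply/orP.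
  case: (split_ordP i) => j ->; [left|right].
    by apply/imsetP; exists (j, b).
  by apply/imsetP; exists (j, b).
rewrite un /partition; apply/and3P; split.
- rewrite /tens_blocks /cover bigcup_setU.
  by have:= cover_partition hP'; rewrite /cover => ->;
     have:= cover_partition hQ'; rewrite /cover => ->.
- apply: trivIsetU; [exact: partition_trivIset hP'|exact: partition_trivIset hQ'|].
  by rewrite (cover_partition hP') (cover_partition hQ').
- by rewrite !inE (partition0 hP') (partition0 hQ').
Qed.

Definition dtens (p q : diagram) : diagram :=
  mkdiagram (partition_tens (valP (tagged p)) (valP (tagged q))).

Definition merge (T : finType) (P : {set {set T}}) (x y : T) : {set {set T}} :=
  (pblock P x :|: pblock P y) |: (P :\ pblock P x :\ pblock P y).

Lemma partition_merge (T : finType) (P : {set {set T}}) (x y : T) :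
  partition P [set: T] -> partition (merge P x y) [set: T].
Proof.
move=> hP; have inb z : pblock P z \in P.
  by apply: pblock_mem; rewrite (cover_partition hP) inE.
rewrite /merge; set a := pblock P x; set b := pblock P y.
have ha : a \in P by exact: inb.
have hb : b \in P by exact: inb.
have hPa := partitionD1 hP ha.
have a0 := partition_neq0 hP ha.
have [eab|nab] := eqVneq b a.
  suff -> : P :\ a :\ b = P :\ a by rewrite eab setUid setD1K.
  by apply/setP => B; rewrite eab !inE andbA andbb.
have hb' : b \in P :\ a by rewrite !inE nab.
have hPab := partitionD1 hPa hb'.
have -> : [set: T] = (a :|: b) :|: ([set: T] :\: a :\: b).
  by apply/setP => z; rewrite !inE; case: (z \in a) => //=; case: (z \in b).
apply: partitionU1 => //.
  by rewrite setU_eq0 negb_and a0.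
rewrite -setI_eq0; apply/eqP/setP => z; rewrite !inE.
by case: (z \in a); case: (z \in b).
Qed.

(* When one factor has order 0, it is dempty and the result is the other one. *)
Definition dbul (p q : diagram) : diagram :=
  match p, q with
  | existT 0 _, _ => q
  | _, existT 0 _ => p
  | existT k.+1 P, existT m.+1 Q =>
      mkdiagram (partition_merge (lsh m.+1 (ord_max : 'I_k.+1, true))
                                 (rsh k.+1 (ord0 : 'I_m.+1, true))
                                 (partition_tens (valP P) (valP Q)))
  end.

Definition castl (k m : nat) (e : k = m) (x : label k) : label m :=
  (cast_ord e x.1, x.2).

Lemma mkdiagram_eq k m (e : k = m) (P : {set {set label k}})
    (Q : {set {set label m}}) hP hQ :
  Q = [set castl e @: (B : {set label k}) | B in P] ->
  @mkdiagram k P hP = @mkdiagram m Q hQ.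
Proof.
case: m / e Q hQ => Q hQ eQ.
have {eQ}E : Q = P.
  rewrite eQ -[RHS]imset_id; apply: eq_imset => B.
  rewrite -[RHS]imset_id; apply: eq_imset => -[i b].
  by rewrite /castl cast_ord_id.
by move: hQ; rewrite E => hQ; rewrite (bool_irrelevance hP hQ).
Qed.

Lemma mkdiagramE (p : diagram) : p = mkdiagram (valP (tagged p)).
Proof. by case: p => k P; rewrite /mkdiagram; congr (Tagged _ _); apply: val_inj. Qed.

Lemma dtens1p : left_id dempty dtens.
Proof.
move=> p; rewrite [RHS]mkdiagramE /dtens; apply: (mkdiagram_eq (e := erefl)) => /=.
case: p => k [P hP] /=; rewrite /tens_blocks imset0 set0U -imset_comp.
rewrite -[LHS]imset_id; apply: eq_imset => B /=; rewrite -imset_comp.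
rewrite -[LHS]imset_id; apply: eq_imset => -[i b] /=.
by congr pair; apply: val_inj.
Qed.

Lemma dtensp1 : right_id dempty dtens.
Proof.
move=> p; rewrite [RHS]mkdiagramE /dtens.
apply: (mkdiagram_eq (e := addn0 _)) => /=.
case: p => k [P hP] /=; rewrite /tens_blocks imset0 setU0 -imset_comp.
rewrite -[LHS]imset_id; apply: eq_imset => B /=; rewrite -imset_comp.
rewrite -[LHS]imset_id; apply: eq_imset => -[i b] /=.
by congr pair; apply: val_inj.
Qed.

Lemma dtensA : associative dtens.
Proof.
move=> p q r; apply/esym/(mkdiagram_eq (e := esym (addnA _ _ _))) => /=.
case: p q r => [k [P hP]] [m [Q hQ]] [n [R hR]] /=.
rewrite /tens_blocks !imsetU -!imset_comp -setUA; congr (_ :|: (_ :|: _));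
  apply: eq_imset => B /=; rewrite -!imset_comp; apply: eq_imset => -[i b] /=;
  by congr pair; apply: val_inj; rewrite /= ?addnA.
Qed.

Lemma order_dtens p q : order (dtens p q) = (order p + order q)%N.
Proof. by []. Qed.

Lemma order_eq0 p : (order p == 0) = (p == dempty).
Proof.
apply/eqP/eqP => [|-> //]; case: p => k [P hP]; rewrite /order /= => k0.
subst k; apply: (mkdiagram_eq (e := erefl)).
have := hP; rewrite (_ : [set: label 0] = set0); last by apply/setP => -[[]].
by rewrite partition_set0 => /eqP ->; rewrite imset0.
Qed.

Lemma dtens_eq1 p q : dtens p q = dempty -> p = dempty /\ q = dempty.
Proof.
move/eqP; rewrite -order_eq0 order_dtens addn_eq0 !order_eq0.
by case/andP => /eqP -> /eqP ->.
Qed.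

HB.instance Definition _ := Monoid.isLaw.Build diagram dempty dtens
  dtensA dtens1p dtensp1.

(* {malg K[diagram]} is thereby the monoid algebra of (diagram, dtens). *)
HB.instance Definition _ := Choice_isMonomialDef.Build diagram
  dtensA dtens1p dtensp1 dtens_eq1.

Section PairMonom.
Variables M N : monomType.
Implicit Types x y z : (M * N)%type.

Definition pone : M * N := (mone, mone).
Definition pmul x y : M * N := (mmul x.1 y.1, mmul x.2 y.2).

Lemma pmulA : associative pmul.
Proof. by move=> x y z; rewrite /pmul !mulmA. Qed.
Lemma pmul1m : left_id pone pmul.
Proof. by move=> [x y]; rewrite /pmul !mul1m. Qed.
Lemma pmulm1 : right_id pone pmul.
Proof. by move=> [x y]; rewrite /pmul !mulm1. Qed.
Lemma pmul_eq1 x y : pmul x y = pone -> x = pone /\ y = pone.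
Proof.
by case: x y => [a b] [c d] [] /unitm[-> ->] /unitm[-> ->].
Qed.

HB.instance Definition _ := Choice_isMonomialDef.Build (M * N)%type
  pmulA pmul1m pmulm1 pmul_eq1.
End PairMonom.

Definition bdiagram (n : nat) : finType := {a : 'I_n.+1 & diagram_of a}.
Definition bval (n : nat) (p : bdiagram n) : diagram :=
  Tagged diagram_of (tagged p).

(* Orders add up under dtens and dbul, so bounding the orders loses nothing: see
   tens_irrP and bul_irrP. The sums over bdiagram below are complete for the
   same reason. *)
Definition tens_irr (p : diagram) : bool :=
  [forall q : bdiagram (order p), forall r : bdiagram (order p),
    (dtens (bval q) (bval r) == p) ==>
      ((bval q == dempty) || (bval r == dempty))].

Definition bul_irr (p : diagram) : bool :=
  [forall q : bdiagram (order p), forall r : bdiagram (order p),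
    (dbul (bval q) (bval r) == p) ==>
      ((bval q == dempty) || (bval r == dempty))].

Lemma bval_exists n q : (order q <= n)%N -> exists b : bdiagram n, bval b = q.
Proof.
case: q => k P; rewrite /order /= => le_kn.
by exists (Tagged (fun a : 'I_n.+1 => diagram_of a)
             (P : diagram_of (Ordinal (le_kn : (k < n.+1)%N)))).
Qed.

Lemma bval_inj n : injective (@bval n).
Proof.
move=> [a P] [b Q] eab; have e : a = b by apply/val_inj/(congr1 order eab).
case: b / e Q eab => Q /eqP; rewrite /bval eq_Tagged => /eqP e.
by congr (Tagged _ _).
Qed.

Lemma order_dbul p q : order (dbul p q) = (order p + order q)%N.
Proof. by case: p q => [[|k] P] [[|m] Q]; rewrite /order /= ?addn0. Qed.

Lemma tens_irrP p :
  reflect (forall q r, dtens q r = p -> q = dempty \/ r = dempty) (tens_irr p).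
Proof.
apply: (iffP forallP) => [irr q r e|irr q].
  have eo : order p = (order q + order r)%N by rewrite -order_dtens e.
  have [|b eb] := @bval_exists (order p) q; first by rewrite eo leq_addr.
  have [|c ec] := @bval_exists (order p) r; first by rewrite eo leq_addl.
  have /forallP/(_ c) := irr b; rewrite eb ec.
  by move/implyP => h; case/orP: (h (introT eqP e)) => /eqP; [left|right].
apply/forallP => r; apply/implyP => /eqP/irr.
by case => ->; rewrite eqxx ?orbT.
Qed.

Lemma bul_irrP p :
  reflect (forall q r, dbul q r = p -> q = dempty \/ r = dempty) (bul_irr p).
Proof.
apply: (iffP forallP) => [irr q r e|irr q].
  have eo : order p = (order q + order r)%N by rewrite -order_dbul e.
  have [|b eb] := @bval_exists (order p) q; first by rewrite eo leq_addr.
  have [|c ec] := @bval_exists (order p) r; first by rewrite eo leq_addl.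
  have /forallP/(_ c) := irr b; rewrite eb ec.
  by move/implyP => h; case/orP: (h (introT eqP e)) => /eqP; [left|right].
apply/forallP => r; apply/implyP => /eqP/irr.
by case => ->; rewrite eqxx ?orbT.
Qed.

Definition tens_factorization (p : diagram) (s : seq diagram) : bool :=
  all (fun q => (q != dempty) && tens_irr q) s &&
  (\big[dtens/dempty]_(q <- s) q == p).

Lemma tens_factorization_exists p : exists s, tens_factorization p s.
Proof.
have [n] := ubnP (order p); elim: n p => // n IH p; rewrite ltnS => le_pn.
have [->|p0] := eqVneq p dempty; first by exists [::]; rewrite /tens_factorization /= big_nil.
have [irr|] := boolP (tens_irr p).
  by exists [:: p]; rewrite /tens_factorization /= p0 irr big_seq1 eqxx.
case/forallPn => q /forallPn[r]; rewrite negb_imply negb_or.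
case/and3P => /eqP e q0 r0.
move: (bval q) (bval r) e q0 r0 => {}q {}r e q0 r0.
have ep : (order q + order r)%N = order p := congr1 order e.
rewrite -order_eq0 -lt0n in q0; rewrite -order_eq0 -lt0n in r0.
have [|s /andP[hs /eqP es]] := IH q.
  by apply: leq_trans le_pn; rewrite -ep -addn1 leq_add2l.
have [|t /andP[ht /eqP et]] := IH r.
  by apply: leq_trans le_pn; rewrite -ep -add1n leq_add2r.
by exists (s ++ t); rewrite /tens_factorization all_cat hs ht big_cat /= es et; apply/eqP.
Qed.

Definition tfactors (p : diagram) : seq diagram :=
  xchoose (tens_factorization_exists p).

Definition dlength (p : diagram) : nat := size (tfactors p).

Definition atomic (p : diagram) : bool :=
  [&& p != dempty, tens_irr p & bul_irr p].

(* true selects dbul, false selects dtens; the bracketing is immaterial, since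
   the two operations associate with each other on non-empty diagrams. *)
Definition mixed_prod (p : diagram) (s : seq (bool * diagram)) : diagram :=
  foldl (fun q x => if x.1 then dbul q x.2 else dtens q x.2) p s.

Definition Aset (n : nat) (p : diagram) : Prop := order p = n.

Definition Iset (n : nat) (p : diagram) : Prop :=
  if n is m.+1 then
    exists q s, [/\ size s = m, atomic q, all (fun x => atomic x.2) s
                  & p = mixed_prod q s]
  else p = dempty.

Definition Pset (n : nat) (p : diagram) : Prop := dlength p = n.

Local Open Scope ring_scope.

Section LinearAlgebra.
Variable K : fieldType.

Definition subspace (V : lmodType K) (W : V -> Prop) : Prop :=
  W 0 /\ (forall (a : K) x y, W x -> W y -> W (a *: x + y)).

Definition span (V : lmodType K) (X : V -> Prop) (v : V) : Prop :=
  exists s : seq (K * V),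
    (forall c, c \in s -> X c.2) /\ v = \sum_(c <- s) c.1 *: c.2.

Definition incl (V : Type) (U W : V -> Prop) : Prop := forall v, U v -> W v.

Definition addsp (V : lmodType K) (U W : V -> Prop) (v : V) : Prop :=
  exists x y, [/\ U x, W y & v = x + y].

Definition sumsp (V : lmodType K) (n : nat) (W : 'I_n -> V -> Prop) (v : V) :
    Prop :=
  exists x : 'I_n -> V, (forall i, W i (x i)) /\ v = \sum_(i < n) x i.

Definition lext (B : choiceType) (V : lmodType K) (f : B -> V)
    (u : {malg K[B]}) : V :=
  \sum_(b <- msupp u) u@_b *: f b.

(* The tensor product of the free modules on B and C is modelled by the free
   module on B * C. *)
Definition tens (B C : choiceType) (u : {malg K[B]}) (v : {malg K[C]}) :
    {malg K[(B * C)%type]} :=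
  \sum_(b <- msupp u) \sum_(c <- msupp v) << u@_b * v@_c *g (b, c) >>.

Definition tenssp (B C : choiceType) (U : {malg K[B]} -> Prop)
    (W : {malg K[C]} -> Prop) : {malg K[(B * C)%type]} -> Prop :=
  span (fun t => exists u w, [/\ U u, W w & t = tens u w]).

Definition tensmap (B C : choiceType) (f : {malg K[B]} -> {malg K[B]})
    (g : {malg K[C]} -> {malg K[C]}) :
    {malg K[(B * C)%type]} -> {malg K[(B * C)%type]} :=
  lext (fun p => tens (f << p.1 >>) (g << p.2 >>)).

End LinearAlgebra.

(* Only the operations: no axioms are bundled. *)
Record hopf_ops (K : fieldType) (B : choiceType) := HopfOps {
  hmul : {malg K[B]} -> {malg K[B]} -> {malg K[B]};
  hone : {malg K[B]};
  hcomul : {malg K[B]} -> {malg K[(B * B)%type]};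
  hcounit : {malg K[B]} -> K
}.

Section Hopf.
Variables (K : fieldType) (B : choiceType) (H : hopf_ops K B).
Local Notation A := {malg K[B]}.

Definition hmul_tens : {malg K[(B * B)%type]} -> A :=
  lext (fun p => hmul H << p.1 >> << p.2 >>).

Definition is_antipode (S : {linear A -> A}) : Prop :=
  (forall x, hmul_tens (tensmap S idfun (hcomul H x)) = hcounit H x *: hone H) /\
  (forall x, hmul_tens (tensmap idfun S (hcomul H x)) = hcounit H x *: hone H).

Definition filtration (V : nat -> A -> Prop) : Prop :=
  [/\ forall n, subspace (V n),
      forall n, incl (V n) (V n.+1)
    & forall x, exists n, V n x].

Definition coalgebra_filtration (V : nat -> A -> Prop) : Prop :=
  filtration V /\
  forall n x, V n x ->
    sumsp (fun i : 'I_n.+1 => tenssp (V i) (V (n - i)%N)) (hcomul H x).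

Definition algebra_filtration (V : nat -> A -> Prop) : Prop :=
  filtration V /\
  forall n m x y, V n x -> V m y -> V (n + m)%N (hmul H x y).

Definition hopf_filtration (V : nat -> A -> Prop) : Prop :=
  [/\ coalgebra_filtration V,
      algebra_filtration V,
      exists S, is_antipode S
    & forall S, is_antipode S -> forall n x, V n x -> V n (S x)].

Definition subcoalgebra (D : A -> Prop) : Prop :=
  subspace D /\ (forall x, D x -> tenssp D D (hcomul H x)).

Definition simple_subcoalgebra (D : A -> Prop) : Prop :=
  [/\ subcoalgebra D,
      exists x, D x /\ x <> 0
    & forall E, subcoalgebra E -> incl E D ->
        (forall x, E x -> x = 0) \/ incl D E].

Definition coradical : A -> Prop :=
  span (fun x => exists D, simple_subcoalgebra D /\ D x).

Fixpoint coradical_filtration (n : nat) : A -> Prop :=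
  if n is m.+1 then
    fun x => addsp (tenssp (fun _ => True) (coradical_filtration m))
                   (tenssp coradical (fun _ => True)) (hcomul H x)
  else coradical.

End Hopf.

Section ParSymParQSym.
Variable K : fieldType.
Local Notation A := {malg K[diagram]}.
Local Notation A2 := {malg K[(diagram * diagram)%type]}.

(* Here << p >> is the basis element H_p. *)
Definition psym_comul_irr (s : diagram) : A2 :=
  \sum_(p : bdiagram (order s))
    \sum_(q : bdiagram (order s) |
          [&& tens_irr (bval p), tens_irr (bval q)
            & dbul (bval p) (bval q) == s])
      << (bval p, bval q) >>.

Definition ParSym : hopf_ops K diagram := {|
  hmul := fun u v => u * v;
  hone := << dempty >>;
  hcomul := lext (fun p => \prod_(s <- tfactors p) psym_comul_irr s);
  hcounit := fun u => u@_dempty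
|}.

(* Here << p >> is the basis element M_p. *)
Definition pqsym_comul_basis (s : diagram) : A2 :=
  \sum_(p : bdiagram (order s))
    \sum_(q : bdiagram (order s) | dtens (bval p) (bval q) == s)
      << (bval p, bval q) >>.

Definition inflates (k n : nat) (t : k.-tuple (bdiagram n))
    (s : seq diagram) : bool :=
  [seq p <- map (@bval n) t | p != dempty] == s.

(* As no position may be empty in both sequences, k is at most the sum of the
   two lengths; entries of the sequences are factors or empty, hence of bounded
   order. *)
Definition pqsym_mul_basis (r s : diagram) : A :=
  \sum_(k < (dlength r + dlength s).+1)
    \sum_(t : k.-tuple (bdiagram (order r)) | inflates t (tfactors r))
      \sum_(u : k.-tuple (bdiagram (order s)) |
            inflates u (tfactors s) &&
            [forall i, dbul (bval (tnth t i)) (bval (tnth u i)) != dempty])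
        << \big[dtens/dempty]_(i < k) dbul (bval (tnth t i)) (bval (tnth u i)) >>.

Definition ParQSym : hopf_ops K diagram := {|
  hmul := fun u v => lext (fun r => lext (fun s => pqsym_mul_basis r s) v) u;
  hone := << dempty >>;
  hcomul := lext pqsym_comul_basis;
  hcounit := fun u => u@_dempty
|}.

Definition filt (X : nat -> diagram -> Prop) (k : nat) : A -> Prop :=
  span (fun x => exists i p, [/\ (i <= k)%N, X i p & x = << p >>]).

End ParSymParQSym.

Arguments filt K X k : clear implicits.

(* Main.v *)
(* Both tensor and bullet are governed by one cancellation law: if two products
   of non-empty diagrams agree and the first factors have different orders, the
   longer first factor splits accordingly (dop_levi). This gives unique
   factorizations, hence the additivity of order, of the number of tensor factors
   and of the number of atomic factors.

   The antipode of ParSym is antimultiplicative, and on tensor-irreducible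
   diagrams it is the two-sided convolution inverse for the deconcatenation of
   bullet. Since the structure constants of ParQSym are those of ParSym transposed
   (pqsym_mul_dual), its antipode is the transpose of the one of ParSym. For any
   antipode, S(p) is minus a sum of terms S(a)b with a of smaller order, so that
   S preserves every filtration that is compatible with product and coproduct.

   The coradical of ParQSym is the line spanned by the empty diagram: contracting
   the deconcatenation of x against a longest diagram of x gives a non-zero
   multiple of the unit. *)
From Pilot Require Import Defs.
From mathcomp Require Import all_boot all_order all_algebra.
From mathcomp Require Import monalg.
From HB Require Import structures.
From mathcomp Require Import finmap.
From Stdlib Require Import Classical_Prop.
(* fingraph also exports a constant named order. *)
Import Pilot.Defs.

Set Implicit Arguments.
Unset Strict Implicit.
Unset Printing Implicit Defensive.

Import GRing.Theory.

(** * Diagrams as relations *)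

(** The order and the number of atomic factors are additive for both operations, so one argument
    ([additive_degree]) serves them in both Hopf algebras. The number of tensor factors is not:
    [dbul] fuses two irreducible diagrams into one. On the support of the coproduct of ParSym only
    [dlength p <= dlength a + dlength b] remains. Transposed, this is the bound required of the
    product of ParQSym; in ParSym it points the wrong way, whence the negative half of (c). Every
    filtration here is spanned by basis elements, so membership is a condition on supports
    ([suppin]), and the work becomes combinatorics of diagrams. *)

Definition lab (k : nat) (x : label k) : nat * bool := (val x.1, x.2).

Definition blocks (p : diagram) : {set {set label (order p)}} := val (tagged p).

(* Same-block relation on untyped labels: it makes diagrams of provably but not
   definitionally equal orders comparable without casts. *)
Definition srel (p : diagram) (u v : nat * bool) : bool :=
  [exists x, exists y, [&& lab x == u, lab y == v & y \in pblock (blocks p) x]].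

Lemma lab_inj k : injective (@lab k).
Proof. by move=> [i b] [j c] [/val_inj -> ->]. Qed.

Lemma blocksP p : partition (blocks p) [set: label (order p)].
Proof. exact: (valP (tagged p)). Qed.

Lemma srel_lab p (x y : label (order p)) :
  srel p (lab x) (lab y) = (y \in pblock (blocks p) x).
Proof.
apply/existsP/idP => [[x' /existsP[y' /and3P[/eqP/lab_inj-> /eqP/lab_inj->]]] //|h].
by exists x; apply/existsP; exists y; rewrite !eqxx.
Qed.

Lemma srel_lt p u v : srel p u v -> (u.1 < order p) && (v.1 < order p).
Proof.
case/existsP => x /existsP[y /and3P[/eqP<- /eqP<- _]].
by rewrite !ltn_ord.
Qed.

Lemma labP k u : (u.1 < k)%N -> exists x : label k, u = lab x.
Proof. by case: u => i b /= h; exists (Ordinal h, b). Qed.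

Lemma srel_refl p u : (u.1 < order p)%N -> srel p u u.
Proof.
case/labP => x ->; rewrite srel_lab mem_pblock.
by rewrite (cover_partition (blocksP p)) inE.
Qed.

Lemma mem_pblockC p (x y : label (order p)) :
  (y \in pblock (blocks p) x) = (pblock (blocks p) x == pblock (blocks p) y).
Proof.
rewrite eq_pblock ?(partition_trivIset (blocksP p)) //.
by rewrite (cover_partition (blocksP p)) inE.
Qed.

Lemma srel_sym p u v : srel p u v = srel p v u.
Proof.
suff h a b : srel p a b -> srel p b a by apply/idP/idP; apply: h.
move=> hab; have /andP[] := srel_lt hab.
case/labP => x ex; case/labP => y ey; move: hab.
by rewrite ex ey !srel_lab !mem_pblockC eq_sym.
Qed.

Lemma srel_trans p u v w : srel p u v -> srel p v w -> srel p u w.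
Proof.
move=> huv hvw; have /andP[] := srel_lt huv; have /andP[_] := srel_lt hvw.
case/labP => z ez; case/labP => x ex; case/labP => y ey; move: huv hvw.
by rewrite ex ey ez !srel_lab !mem_pblockC => /eqP ->.
Qed.

Lemma srel_pblock k (P : {set {set label k}}) (hP : partition P [set: label k]) x y :
  srel (mkdiagram hP) (lab x) (lab y) = (y \in pblock P x).
Proof. exact: (srel_lab (p := mkdiagram hP)). Qed.

Lemma partition_imset (T : finType) (P : {set {set T}}) :
  partition P [set: T] -> P = [set pblock P x | x : T].
Proof.
move=> hP; apply/setP => B; apply/idP/imsetP => [hB|[x _ ->]].
  have /set0Pn[x xB] := partition_neq0 hP hB.
  by exists x => //; rewrite (def_pblock (partition_trivIset hP) hB xB).
by apply: pblock_mem; rewrite (cover_partition hP) inE.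
Qed.

Lemma diagram_ext p q : order p = order q -> srel p =2 srel q -> p = q.
Proof.
case: p q => k P [m Q]; rewrite /order /= => e; case: m / e Q => Q h.
congr (Tagged _ _); apply: val_inj.
have hP := valP P; have hQ := valP Q.
rewrite [LHS]partition_imset // [RHS]partition_imset //.
apply: eq_imset => x; apply/setP => y.
by have := h (lab x) (lab y); rewrite !(@srel_lab (Tagged diagram_of _)).
Qed.

Definition shiftl (k : nat) (u : nat * bool) : nat * bool := ((u.1 - k)%N, u.2).

Lemma pblock_tens_l k m (P : {set {set label k}}) (Q : {set {set label m}}) x :
  partition P [set: label k] -> partition Q [set: label m] ->
  pblock (tens_blocks P Q) (lsh m x) = lsh m @: pblock P x.
Proof.
move=> hP hQ; have hT := partition_tens hP hQ.
apply: def_pblock; first exact: partition_trivIset hT.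
  rewrite !inE; apply/orP; left; apply: imset_f.
  by apply: pblock_mem; rewrite (cover_partition hP) inE.
by apply: imset_f; rewrite mem_pblock (cover_partition hP) inE.
Qed.

Lemma pblock_tens_r k m (P : {set {set label k}}) (Q : {set {set label m}}) x :
  partition P [set: label k] -> partition Q [set: label m] ->
  pblock (tens_blocks P Q) (rsh k x) = @rsh k m @: pblock Q x.
Proof.
move=> hP hQ; have hT := partition_tens hP hQ.
apply: def_pblock; first exact: partition_trivIset hT.
  rewrite !inE; apply/orP; right; apply: imset_f.
  by apply: pblock_mem; rewrite (cover_partition hQ) inE.
by apply: imset_f; rewrite mem_pblock (cover_partition hQ) inE.
Qed.

Lemma label_split k m (z : label (k + m)) :
  (exists x : label k, z = lsh m x) \/ (exists x : label m, z = rsh k x).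
Proof.
case: z => i b; case: (split_ordP i) => j ->; [left|right].
  by exists (j, b).
by exists (j, b).
Qed.

(** The new pairs have one point in each of the two blocks; if x and y already share a block, the
    last two disjuncts are absorbed by the first. *)
Lemma pblock_merge (T : finType) (P : {set {set T}}) (x y z w : T) :
  partition P [set: T] ->
  (w \in pblock (merge P x y) z) =
    [|| w \in pblock P z,
        (w \in pblock P x) && (z \in pblock P y) |
        (w \in pblock P y) && (z \in pblock P x)].
Proof.
move=> hP; have hM := partition_merge x y hP.
have tP := partition_trivIset hP; have tM := partition_trivIset hM.
have cP a : a \in cover P by rewrite (cover_partition hP) inE.
have inb a : pblock P a \in P by apply: pblock_mem.
have hin a b : (a \in pblock P b) = (pblock P b == pblock P a).
  by rewrite eq_pblock.
have [hz|hz] := boolP (z \in pblock P x :|: pblock P y).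
  rewrite (def_pblock tM _ hz); last by rewrite /merge !inE eqxx.
  move: hz; rewrite !inE !hin.
  by case/orP => /eqP <-; rewrite eqxx ?andbT // orbA; do 2 case: (_ == _).
rewrite (@def_pblock _ _ (pblock P z)) //.
- by move: hz; rewrite inE negb_or => /andP[/negbTE -> /negbTE ->]; rewrite !andbF !orbF.
- move: hz; rewrite /merge !inE inb !hin ![pblock P z == _]eq_sym.
  by rewrite negb_or => /andP[/negbTE -> /negbTE ->]; rewrite orbT.
- by rewrite mem_pblock.
Qed.

(* [dop b] is \bullet for b = true and \otimes for b = false, so that both can
   be factored, associated and cancelled at once. *)
Definition dop (b : bool) (p q : diagram) : diagram :=
  if b then dbul p q else dtens p q.

Lemma order_dop b p q : order (dop b p q) = (order p + order q)%N.
Proof. by case: b; rewrite /dop ?order_dbul ?order_dtens. Qed.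

(** [shiftl] truncates at 0, so the guard on v in the second branch keeps a label of p from being
    read as one in the first column of q. *)
Lemma srel_dtens p q u v :
  srel (dtens p q) u v =
  if (u.1 < order p)%N then (v.1 < order p)%N && srel p u v
  else (order p <= v.1)%N && srel q (shiftl (order p) u) (shiftl (order p) v).
Proof.
have hP := blocksP p; have hQ := blocksP q.
have E x y : srel (dtens p q) (lab x) (lab y) =
   (y \in pblock (tens_blocks (blocks p) (blocks q)) x).
  exact: (@srel_lab (dtens p q)).
have [/andP[hu hv]|nlt] :=
   boolP ((u.1 < order p + order q) && (v.1 < order p + order q)); last first.
  have -> : srel (dtens p q) u v = false.
    by apply: contraNF nlt => /srel_lt; rewrite order_dtens.
  apply/esym; case: ifP => hu; apply: contraNF nlt => /andP[hv].
    by move=> _; rewrite !ltn_addr.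
  case/srel_lt/andP => /= h1 h2.
  rewrite leqNgt in hv; rewrite -ltnNge ltnS in hv.
  move/negbT: hu; rewrite -leqNgt => hu.
  by rewrite -!ltn_subLR // h1 h2.
case: (labP hu) => x ->; case: (labP hv) => y ->; rewrite E.
case: (label_split x) => -[{}x ->]; case: (label_split y) => -[{}y ->];
  rewrite ?pblock_tens_l ?pblock_tens_r //= ?ltn_ord //=.
- by rewrite mem_imset ?srel_lab //; exact: lsh_inj.
- rewrite ltnNge leq_addr /=; apply/imsetP => -[[i b] _ []] /= e _.
  by have := ltn_ord i; rewrite -e ltnNge leq_addr.
- rewrite ltnNge leq_addr /= leqNgt ltn_ord /=.
  apply/imsetP => -[[i b] _ []] /= e _.
  by have := ltn_ord y.1; rewrite e ltnNge leq_addr.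
- rewrite ltnNge leq_addr /= leq_addr /= /shiftl /= !addKn.
  by rewrite mem_imset ?srel_lab //; exact: rsh_inj.
Qed.

Lemma dempty_order p : p != dempty -> (0 < order p)%N.
Proof. by rewrite -order_eq0 lt0n. Qed.

(** The labels [((order p).-1, true)] and [(0, true)] are those at which \bullet glues; only the
    mixed entries depend on b. *)
Lemma srel_dop b p q u v : p != dempty -> q != dempty ->
  srel (dop b p q) u v =
  if (u.1 < order p)%N then
    if (v.1 < order p)%N then srel p u v
    else [&& b, srel p u ((order p).-1, true) & srel q (0, true) (shiftl (order p) v)]
  else
    if (v.1 < order p)%N then
      [&& b, srel p v ((order p).-1, true) & srel q (0, true) (shiftl (order p) u)]
    else srel q (shiftl (order p) u) (shiftl (order p) v).
Proof.
move=> p0 q0; case: b; last first.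
  by rewrite /dop srel_dtens; case: ltnP => //; case: ltnP.
set a : nat * bool := ((order p).-1, true).
set c : nat * bool := (order p, true).
have -> : srel (dop true p q) u v =
  [|| srel (dtens p q) u v,
      srel (dtens p q) a v && srel (dtens p q) c u |
      srel (dtens p q) c v && srel (dtens p q) a u].
  rewrite /dop {}/a {}/c.
  case: p q p0 q0 => [[|k] P] [[|m] Q]; rewrite -?order_eq0 // => _ _.
  set pp : diagram := Tagged diagram_of P; set qq : diagram := Tagged diagram_of Q.
  have hP := valP P; have hQ := valP Q.
  have hT := partition_tens hP hQ.
  have [/andP[hu hv]|nlt] :=
    boolP ((u.1 < k.+1 + m.+1) && (v.1 < k.+1 + m.+1)); last first.
    have nl f : order f = (k.+1 + m.+1)%N -> srel f u v = false.
      by move=> ef; apply: contraNF nlt => /srel_lt; rewrite ef.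
    rewrite nl ?order_dbul // nl //=; apply/esym; apply: contraNF nlt.
    by case/orP => /andP[] /srel_lt/andP[_ ->] /srel_lt/andP[_ ->].
  case: (labP hu) => x ->; case: (labP hv) => y ->.
  have := srel_pblock (partition_merge (lsh m.+1 (ord_max : 'I_k.+1, true))
                                 (rsh k.+1 (ord0 : 'I_m.+1, true))
                                 (partition_tens (valP P) (valP Q))) x y.
  move=> e; rewrite [LHS]e pblock_merge //.
  have -> : ((order pp).-1, true) = lab (lsh m.+1 (ord_max : 'I_k.+1, true)) by [].
  have -> : (order pp, true) = lab (rsh k.+1 (ord0 : 'I_m.+1, true)).
    by rewrite /lab /= addn0.
  have et x' y' : srel (dtens pp qq) (lab x') (lab y') =
      (y' \in pblock (tens_blocks (val P) (val Q)) x').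
    exact: srel_pblock.
  by rewrite !et.
have pk : (order p).-1 < order p by rewrite prednK ?dempty_order.
rewrite !srel_dtens /= ltnn pk.
have -> : shiftl (order p) c = (0, true) by rewrite /shiftl subnn.
case: (ltnP u.1) => hu; case: (ltnP v.1) => hv; rewrite /= ?andbF ?orbF //.
- by rewrite (srel_sym p a) andbC.
- by rewrite (srel_sym p a).
Qed.

(** * Cancellation *)

(* The disjunct x == y only serves to make this total when order p < m. *)
Definition take_rel (p : diagram) (m : nat) : rel (label m) :=
  fun x y => (x == y) || srel p (lab x) (lab y).

Lemma take_rel_equiv p m :
  {in [set: label m] & &, equivalence_rel (take_rel p (m := m))}.
Proof.
move=> x y z _ _ _; rewrite /take_rel eqxx; split => //.
case/orP => [/eqP-> //|hxy]; apply/orP/orP => -[/eqP e|h]; right.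
- by rewrite -e srel_sym.
- by apply: srel_trans h; rewrite srel_sym.
- by rewrite -e.
- exact: srel_trans h.
Qed.

Definition dtake (m : nat) (p : diagram) : diagram :=
  mkdiagram (equivalence_partitionP (@take_rel_equiv p m)).

Lemma srel_dtake m p u v : (m <= order p)%N ->
  srel (dtake m p) u v = [&& (u.1 < m)%N, (v.1 < m)%N & srel p u v].
Proof.
move=> le_mp.
have [hu|hu] := ltnP u.1 m; last first.
  by apply/negbTE; apply: contraL hu => /srel_lt/andP[]; rewrite -ltnNge.
have [hv|hv] := ltnP v.1 m; last first.
  by apply/negbTE; apply: contraL hv => /srel_lt/andP[_]; rewrite -ltnNge.
case: (labP hu) => x ex; case: (labP hv) => y ->; rewrite {}ex.
rewrite srel_pblock pblock_equivalence_partition ?inE //; last exact: take_rel_equiv.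
rewrite /take_rel.
case: eqVneq => [->|_] /=; last by [].
by rewrite srel_refl //; apply: leq_trans le_mp; exact: ltn_ord.
Qed.

Lemma dop_neq0 b p q : p != dempty -> dop b p q != dempty.
Proof. by rewrite -!order_eq0 order_dop addn_eq0 negb_and => ->. Qed.

Lemma dop_neq0r b p q : q != dempty -> dop b p q != dempty.
Proof. by rewrite -!order_eq0 order_dop addn_eq0 negb_and => ->; rewrite orbT. Qed.

Lemma dop1p b : left_id dempty (dop b).
Proof. by case: b => p; [case: p|exact: dtens1p]. Qed.

Lemma dopp1 b : right_id dempty (dop b).
Proof.
case: b => p; last exact: dtensp1.
have [->|] := eqVneq p dempty; first by [].
by rewrite -order_eq0; case: p => -[].
Qed.

(** A non-empty q separates the two gluings. For empty q the sides would be [dop c p r] and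
    [dop b p r]. *)
Lemma dopA b c (p q r : diagram) : q != dempty ->
  dop c (dop b p q) r = dop b p (dop c q r).
Proof.
move=> q0; have [->|p0] := eqVneq p dempty; first by rewrite !dop1p.
have [->|r0] := eqVneq r dempty; first by rewrite !dopp1.
apply: diagram_ext => [|u v]; first by rewrite !order_dop addnA.
have oq := dempty_order q0; have op := dempty_order p0.
(* The last label of the product of p and q lies in q, because q is non-empty. *)
have e1 : ((order p + order q).-1 < order p) = false.
  by apply/negbTE; rewrite -leqNgt -subn1 -addnBA // leq_addr.
have e2 : shiftl (order p) ((order p + order q).-1, true) = ((order q).-1, true).
  by rewrite /shiftl /= -subn1 -addnBA // addKn subn1.
have e3 w : shiftl (order p + order q) w = shiftl (order q) (shiftl (order p) w).
  by rewrite /shiftl /= subnDA.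
have e4 w : (w < order p + order q) = (w - order p < order q) || (w < order p).
  case: (ltnP w (order p)) => h; first by rewrite orbT ltn_addr.
  by rewrite orbF ltn_subLR.
rewrite !(srel_dop, dop_neq0, dop_neq0r) // !order_dop /= e1 e2 e3 e4 oq.
rewrite e4 e3.
case: (ltnP u.1 (order p)) => hu; case: (ltnP v.1 (order p)) => hv //=;
  rewrite ?orbT ?orbF //.
- by case: ifP => // _; case: b; case: c => //=; rewrite ?andbF ?andbA.
- by case: ifP => // _; case: b; case: c => //=; rewrite ?andbF ?andbA.
Qed.

Lemma dopA_same b : associative (dop b).
Proof.
move=> p q r; have [->|q0] := eqVneq q dempty; first by rewrite dop1p dopp1.
by rewrite dopA.
Qed.

Lemma dop_cancel b c p q p' q' :
  p != dempty -> q != dempty -> p' != dempty -> q' != dempty ->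
  order p = order p' -> dop b p q = dop c p' q' -> [/\ b = c, p = p' & q = q'].
Proof.
move=> p0 q0 p'0 q'0 e h.
have op := dempty_order p0; have oq := dempty_order q0.
have oqe : order q = order q'.
  by have := congr1 order h; rewrite !order_dop e => /addnI.
have E u v := congr1 (fun d => srel d u v) h.
split.
(* The last primed label of p and the first primed label of q share a block exactly for \bullet,
   which recovers the operation. *)
- have := E ((order p).-1, true) (order p, true).
  have pk : (order p).-1 < order p by rewrite prednK.
  have sh : shiftl (order p) (order p, true) = (0, true) by rewrite /shiftl subnn.
  rewrite /= !srel_dop // -e /= ltnn pk sh !srel_refl ?andbT -?oqe -?e //.
- apply: diagram_ext => // u v.
  have := E u v; rewrite /= !srel_dop // -e.
  have [/andP[-> ->] //|h' _] := boolP ((u.1 < order p) && (v.1 < order p)).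
  by transitivity false; [|apply/esym]; apply: contraNF h' => /srel_lt; rewrite ?e.
- apply: diagram_ext => // u v.
  have := E (order p + u.1, u.2)%N (order p + v.1, v.2)%N.
  rewrite /= !srel_dop //= -e !ltnNge !leq_addr /= /shiftl /= !addKn.
  by case: u v => [? ?] [? ?].
Qed.

(** The analogue of Levi's lemma for words. The middle factor x consists of the first
    [order p' - order p] columns of q. Comparing relations gives the equation for p'; the one for q
    follows by reassociating and cancelling p. *)
Lemma dop_levi b c p q p' q' :
  p != dempty -> q != dempty -> p' != dempty -> q' != dempty ->
  (order p < order p')%N -> dop b p q = dop c p' q' ->
  exists x, [/\ x != dempty, p' = dop b p x & q = dop c x q'].
Proof.
move=> p0 q0 p'0 q'0 lt h.
pose m := (order p' - order p)%N.
have oe : (order p + order q = order p' + order q')%N.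
  by have := congr1 order h; rewrite !order_dop.
have m0 : (0 < m)%N by rewrite subn_gt0.
have em : (order p + m)%N = order p' by rewrite subnKC // ltnW.
have mq : (m <= order q)%N by rewrite -(leq_add2l (order p)) em oe leq_addr.
have x0 : dtake m q != dempty by rewrite -order_eq0 -lt0n.
have e1 : p' = dop b p (dtake m q).
  apply: diagram_ext => [|u v]; first by rewrite order_dop em.
  have := congr1 (fun d => srel d u v) h; rewrite /= !srel_dop //.
  have [/andP[hu hv]|h' _] := boolP ((u.1 < order p') && (v.1 < order p')); last first.
    have /negbTE -> : ~~ srel p' u v by apply: contra h' => /srel_lt.
    rewrite -srel_dop //.
    by apply/esym; apply: contraNF h' => /srel_lt; rewrite order_dop em.
  rewrite hu hv !srel_dtake //= m0 /= => <-.
  have hs (w : nat * bool) :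
      (w.1 < order p')%N -> (order p <= w.1)%N -> (w.1 - order p < m)%N.
    by move=> h1 h2; rewrite ltn_subLR // em.
  by case: (ltnP u.1) => hu'; case: (ltnP v.1) => hv' //; rewrite ?(hs u) ?(hs v).
exists (dtake m q); split => //.
move: h; rewrite e1 dopA // => h.
by have [] := dop_cancel p0 q0 p0 (dop_neq0 _ _ x0) erefl h.
Qed.

(** * Unique factorizations *)

Definition tword (w : seq diagram) : diagram := \big[dtens/dempty]_(q <- w) q.

Definition irrword (w : seq diagram) : bool :=
  all (fun q => (q != dempty) && tens_irr q) w.

Lemma tword_cons s w : tword (s :: w) = dtens s (tword w).
Proof. exact: big_cons. Qed.

Lemma tword_cat v w : tword (v ++ w) = dtens (tword v) (tword w).
Proof. by rewrite /tword big_cat. Qed.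

Lemma tens_irr0 : tens_irr dempty.
Proof. by apply/tens_irrP => q r /dtens_eq1[-> _]; left. Qed.

Lemma tens_irr_dtens p q : p != dempty -> q != dempty -> ~~ tens_irr (dtens p q).
Proof. by move=> /eqP p0 /eqP q0; apply/tens_irrP => /(_ p q erefl) []. Qed.

(** If s and s' had different orders, [dop_levi] would factor the longer one. Empty tails lie
    outside [dop_levi] and are settled first, by irreducibility. *)
Lemma irr_dtens_inj s z s' z' :
  s != dempty -> tens_irr s -> s' != dempty -> tens_irr s' ->
  dtens s z = dtens s' z' -> s = s' /\ z = z'.
Proof.
move=> s0 is_ s'0 is' h.
have [z0|z0] := eqVneq z dempty.
  move: is_ h; rewrite {}z0 dtensp1 => is_ h.
  have [e|e] := tens_irrP s is_ _ _ (esym h); first by rewrite e eqxx in s'0.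
  by move: h; rewrite e dtensp1.
have [z'0|z'0] := eqVneq z' dempty.
  move: is' h; rewrite {}z'0 dtensp1 => is' h.
  have [e|e] := tens_irrP s' is' _ _ h; first by rewrite e eqxx in s0.
  by move: h; rewrite e dtensp1.
have h' : dop false s z = dop false s' z' by [].
case: (ltngtP (order s) (order s')) => o.
- have [x [x0 e _]] := dop_levi s0 z0 s'0 z'0 o h'.
  by have := tens_irr_dtens s0 x0; rewrite -[dtens s x]e is'.
- have [x [x0 e _]] := dop_levi s'0 z'0 s0 z0 o (esym h').
  by have := tens_irr_dtens s'0 x0; rewrite -[dtens s' x]e is_.
- by have [] := dop_cancel s0 z0 s'0 z'0 o h'.
Qed.

Lemma tword_inj v w : irrword v -> irrword w -> tword v = tword w -> v = w.
Proof.
elim: v w => [|s v IH] [|s' w] //=.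
- move=> _ /andP[/andP[s0 _] _]; rewrite tword_cons /tword big_nil => /esym/dtens_eq1[e].
  by rewrite e eqxx in s0.
- move=> /andP[/andP[s0 _] _] _; rewrite tword_cons /tword big_nil => /dtens_eq1[e].
  by rewrite e eqxx in s0.
case/andP => /andP[s0 hs] hv /andP[/andP[s'0 hs'] hw]; rewrite !tword_cons.
by case/(irr_dtens_inj s0 hs s'0 hs') => -> /(IH _ hv hw) ->.
Qed.

Lemma tfactorsP p : irrword (tfactors p) /\ tword (tfactors p) = p.
Proof. by have /andP[h1 /eqP h2] := xchooseP (tens_factorization_exists p). Qed.

Lemma irrword_tfactors p : irrword (tfactors p).
Proof. by case: (tfactorsP p). Qed.

Lemma tword_tfactors p : tword (tfactors p) = p.
Proof. by case: (tfactorsP p). Qed.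

(** [tfactors] is an arbitrary choice; uniqueness lets it be computed from any irreducible word at
    hand. *)
Lemma tfactors_tword w : irrword w -> tfactors (tword w) = w.
Proof. by move=> hw; apply: tword_inj; rewrite ?irrword_tfactors ?tword_tfactors. Qed.

Lemma tfactors_dtens p q : tfactors (dtens p q) = tfactors p ++ tfactors q.
Proof.
rewrite -{1}(tword_tfactors p) -{1}(tword_tfactors q) -tword_cat tfactors_tword //.
by rewrite /irrword all_cat; apply/andP; split; apply: irrword_tfactors.
Qed.

Lemma tfactors0 : tfactors dempty = [::].
Proof.
have -> : dempty = tword [::] by rewrite /tword big_nil.
exact: tfactors_tword.
Qed.

Lemma tfactors_irr s : s != dempty -> tens_irr s -> tfactors s = [:: s].
Proof.
move=> s0 hs; rewrite -[X in tfactors X]dtensp1.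
have -> : dtens s dempty = tword [:: s] by rewrite tword_cons /tword big_nil.
by apply: tfactors_tword; rewrite /= s0 hs.
Qed.

Lemma dlength_dtens p q : dlength (dtens p q) = (dlength p + dlength q)%N.
Proof. by rewrite /dlength tfactors_dtens size_cat. Qed.

Lemma dlength0 : dlength dempty = 0.
Proof. by rewrite /dlength tfactors0. Qed.

Lemma dlength_eq0 p : (dlength p == 0) = (p == dempty).
Proof.
apply/eqP/eqP => [/size0nil e|->]; last exact: dlength0.
by rewrite -(tword_tfactors p) e /tword big_nil.
Qed.

Lemma dlength_irr s : s != dempty -> tens_irr s -> dlength s = 1.
Proof. by move=> s0 hs; rewrite /dlength tfactors_irr. Qed.

(** In [dtens r t = dbul p q], first factors of different orders would make p or q a proper tensor
    product by [dop_levi]; equal orders would identify the two operations by [dop_cancel]. *)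
Lemma tens_irr_dbul p q : tens_irr p -> tens_irr q -> tens_irr (dbul p q).
Proof.
move=> hp hq.
have [->|p0] := eqVneq p dempty; first by rewrite [dbul _ _](dop1p true).
have [->|q0] := eqVneq q dempty; first by rewrite [dbul _ _](dopp1 true).
apply/tens_irrP => r t h; have [->|r0] := eqVneq r dempty; first by left.
have [->|t0] := eqVneq t dempty; first by right.
have h' : dop false r t = dop true p q by [].
case: (ltngtP (order r) (order p)) => o.
- have [x [x0 e _]] := dop_levi r0 t0 p0 q0 o h'.
  by have := tens_irr_dtens r0 x0; rewrite -[dtens r x]e hp.
- have [x [x0 _ e]] := dop_levi p0 q0 r0 t0 o (esym h').
  by have := tens_irr_dtens x0 t0; rewrite -[dtens x t]e hq.
- by have [] := dop_cancel r0 t0 p0 q0 o h'.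
Qed.

(** By mixed associativity a tensor splitting of p or q moves to the outside of [dbul p q]. *)
Lemma tens_irr_dbul_inv p q : tens_irr (dbul p q) -> tens_irr p && tens_irr q.
Proof.
have [->|p0] := eqVneq p dempty.
  by rewrite [dbul _ _](dop1p true) tens_irr0.
have [->|q0] := eqVneq q dempty.
  by rewrite [dbul _ _](dopp1 true) tens_irr0 andbT.
move=> hpq; apply/andP; split; apply/tens_irrP => r t e;
  (have [->|r0] := eqVneq r dempty; first by left);
  (have [->|t0] := eqVneq t dempty; first by right); exfalso.
- have e' : dbul p q = dtens r (dbul t q).
    by rewrite -e; exact: (@dopA false true r t q).
  by move: hpq; rewrite e' (negbTE (tens_irr_dtens _ (dop_neq0 true _ t0))).
- have e' : dbul p q = dtens (dbul p r) t.
    by rewrite -e; symmetry; exact: (@dopA true false p r t).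
  by move: hpq; rewrite e' (negbTE (tens_irr_dtens (dop_neq0 true _ p0) t0)).
Qed.

(** * Factorization into atomic diagrams *)

Lemma mixed_prod_cons p x s :
  mixed_prod p (x :: s) = mixed_prod (dop x.1 p x.2) s.
Proof. by case: x => b q. Qed.

Lemma mixed_prod_rcons p s x :
  mixed_prod p (rcons s x) = dop x.1 (mixed_prod p s) x.2.
Proof. by rewrite /mixed_prod -cats1 foldl_cat; case: x. Qed.

Lemma atomic_neq0 p : atomic p -> p != dempty.
Proof. by case/and3P. Qed.

Lemma atomic_dop b p q : p != dempty -> q != dempty -> ~~ atomic (dop b p q).
Proof.
move=> p0 q0; apply/negP => /and3P[_ /tens_irrP ht /bul_irrP hb].
have [e|e] : p = dempty \/ q = dempty by case: b ht hb => ht hb; [apply: hb|apply: ht].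
  by rewrite e eqxx in p0.
by rewrite e eqxx in q0.
Qed.

Lemma mixed_prod_neq0 p s : p != dempty -> mixed_prod p s != dempty.
Proof. by elim: s p => // x s IH p p0; rewrite mixed_prod_cons IH ?dop_neq0. Qed.

Lemma dop_mixed_prod b p q s :
  q != dempty -> all (fun x => atomic x.2) s ->
  dop b p (mixed_prod q s) = mixed_prod (dop b p q) s.
Proof.
elim: s q => [//|x s IH] q q0 /andP[_ hs].
by rewrite !mixed_prod_cons IH ?dop_neq0 // dopA.
Qed.

(** Compared from the right, since [mixed_prod] nests to the left: prefixes of different orders
    would, by [dop_levi], make one of the last factors a proper product. *)
Lemma mixed_prod_inj p s q t :
  atomic p -> all (fun x => atomic x.2) s ->
  atomic q -> all (fun x => atomic x.2) t ->
  mixed_prod p s = mixed_prod q t -> p = q /\ s = t.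
Proof.
move=> hp + hq; elim/last_ind: s t => [|s x IH] t.
  case/lastP: t => [|t y] //; rewrite all_rcons mixed_prod_rcons => _ /andP[hy ht] e.
  have q0 := mixed_prod_neq0 t (atomic_neq0 hq).
  by have := atomic_dop y.1 q0 (atomic_neq0 hy); rewrite -e hp.
rewrite all_rcons mixed_prod_rcons => /andP[hx hs].
have P0 := mixed_prod_neq0 s (atomic_neq0 hp); have x0 := atomic_neq0 hx.
case/lastP: t => [_ e|t y].
  by have := atomic_dop x.1 P0 x0; rewrite e hq.
rewrite all_rcons mixed_prod_rcons => /andP[hy ht] e.
have Q0 := mixed_prod_neq0 t (atomic_neq0 hq); have y0 := atomic_neq0 hy.
case: (ltngtP (order (mixed_prod p s)) (order (mixed_prod q t))) => o.
- have [z [z0 _ e']] := dop_levi P0 x0 Q0 y0 o e.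
  by have := atomic_dop y.1 z0 y0; rewrite -e' hx.
- have [z [z0 _ e']] := dop_levi Q0 y0 P0 x0 o (esym e).
  by have := atomic_dop x.1 z0 x0; rewrite -e' hy.
- have [e1 e2 e3] := dop_cancel P0 x0 Q0 y0 o e.
  have [-> ->] := IH t hs ht e2; split=> //.
  by rewrite [x]surjective_pairing [y]surjective_pairing e1 e3.
Qed.

Lemma Iset_neq0 n p : Iset n.+1 p -> p != dempty.
Proof. by case=> q [s [_ hq _ ->]]; apply: mixed_prod_neq0; apply: atomic_neq0. Qed.

Lemma Iset_inj n m p : Iset n p -> Iset m p -> n = m.
Proof.
case: n m => [|n] [|m] //.
- by move=> -> /Iset_neq0; rewrite eqxx.
- by move=> /Iset_neq0 + e; rewrite [p]e eqxx.
move=> [q [s [<- hq hs ->]]] [q' [s' [<- hq' hs' e]]].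
by have [_ ->] := mixed_prod_inj hq hs hq' hs' e.
Qed.

Lemma Iset_dop b n m p q : Iset n p -> Iset m q -> Iset (n + m) (dop b p q).
Proof.
case: n m => [|n] [|m].
- by move=> -> ->; rewrite dop1p.
- by move=> -> hq; rewrite dop1p.
- by move=> hp ->; rewrite dopp1 addn0.
move=> [a [s [<- ha hs ->]]] [c [t [<- hc ht ->]]].
exists a, (s ++ (b, c) :: t); split => //.
- by rewrite size_cat /= addnS.
- by rewrite all_cat hs /= hc.
- by rewrite dop_mixed_prod ?atomic_neq0 // /mixed_prod foldl_cat; case: b.
Qed.

Lemma Iset_exists p : exists n, Iset n p.
Proof.
have [n] := ubnP (order p); elim: n p => // n IH p; rewrite ltnS => le_pn.
have [->|p0] := eqVneq p dempty; first by exists 0.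
have [hp|] := boolP (atomic p); first by exists 1, p, [::].
suff h b (q r : bdiagram (order p)) : bval q != dempty -> bval r != dempty ->
     dop b (bval q) (bval r) == p -> exists n, Iset n p.
  rewrite /atomic p0 /= negb_and /tens_irr /bul_irr.
  by case/orP; case/forallPn => q /forallPn[r]; rewrite negb_imply negb_or => /and3P[e q0 r0];
    [apply: (h false q r)|apply: (h true q r)].
move: (bval q) (bval r) => {}q {}r q0 r0 /eqP e.
have eo := congr1 order e; rewrite order_dop in eo.
have oq := dempty_order q0; have or := dempty_order r0.
have [|i hi] := IH q.
  by apply: leq_trans le_pn; rewrite -eo -addn1 leq_add2l.
have [|j hj] := IH r.
  by apply: leq_trans le_pn; rewrite -eo -add1n leq_add2r.
by exists (i + j); rewrite -e; apply: Iset_dop.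
Qed.

Local Open Scope ring_scope.

(** * Finite sums and spans *)

(** The device for exchanging sums over supports, over bounded lists and over [splits]: two index
    lists need to share only the entries where F is non-zero. *)
Lemma big_uniq_supp (T : eqType) (V : nmodType) (r1 r2 : seq T) (F : T -> V) :
  uniq r1 -> uniq r2 ->
  {in r1, forall x, x \notin r2 -> F x = 0} ->
  {in r2, forall x, x \notin r1 -> F x = 0} ->
  \sum_(x <- r1) F x = \sum_(x <- r2) F x.
Proof.
move=> u1 u2 h1 h2.
have E (r r' : seq T) : {in r, forall x, x \notin r' -> F x = 0} ->
    \sum_(x <- r) F x = \sum_(x <- [seq x <- r | x \in r']) F x.
  move=> h; rewrite big_filter [RHS]big_mkcond /= big_seq [RHS]big_seq.
  by apply: eq_bigr => x xr; case: ifP => // /negbT; exact: h.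
rewrite (E _ _ h1) (E _ _ h2); apply: perm_big; apply: uniq_perm; rewrite ?filter_uniq //.
by move=> x; rewrite !mem_filter andbC.
Qed.

Lemma big_uniq_only (T : eqType) (V : nmodType) (r : seq T) (F : T -> V) x0 :
  uniq r -> x0 \in r -> {in r, forall x, x != x0 -> F x = 0} ->
  \sum_(x <- r) F x = F x0.
Proof.
move=> ur x0r h; rewrite -[RHS](big_seq1 +%R x0).
apply: big_uniq_supp => // x; rewrite inE; first exact: h.
by move/eqP->; rewrite x0r.
Qed.

(** Lists over the single type [diagram] make sums over [bdiagram n] comparable for different n. *)
Definition dlist (n : nat) : seq diagram :=
  [seq bval b | b <- index_enum (bdiagram n)].

Lemma dlist_uniq n : uniq (dlist n).
Proof. by rewrite map_inj_uniq ?index_enum_uniq //; exact: bval_inj. Qed.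

Lemma mem_dlist n p : (p \in dlist n) = (order p <= n)%N.
Proof.
apply/mapP/idP => [[b _ ->]|/bval_exists[b <-]]; last by exists b; rewrite ?mem_index_enum.
by rewrite -ltnS; exact: (ltn_ord (tag b)).
Qed.

Definition splits (b : bool) (s : diagram) : seq (diagram * diagram) :=
  [seq x <- [seq (p, q) | p <- dlist (order s), q <- dlist (order s)]
     | dop b x.1 x.2 == s].

Lemma splits_uniq b s : uniq (splits b s).
Proof.
apply/filter_uniq/allpairs_uniq; rewrite ?dlist_uniq //.
by move=> [? ?] [? ?] _ _ [-> ->].
Qed.

Lemma mem_splits b s x : (x \in splits b s) = (dop b x.1 x.2 == s).
Proof.
rewrite mem_filter; have [<- /=|] //= := eqVneq (dop b x.1 x.2) s.
by apply/allpairsP; exists x; rewrite !mem_dlist !order_dop leq_addr leq_addl; case: x.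
Qed.

Lemma splits_order b s x : x \in splits b s -> (order x.1 + order x.2)%N = order s.
Proof. by rewrite mem_splits => /eqP <-; rewrite order_dop. Qed.

Lemma big_bdiagram (V : nmodType) n (F : diagram -> V) :
  \sum_(p : bdiagram n) F (bval p) = \sum_(p <- dlist n) F p.
Proof. by rewrite big_map. Qed.

Lemma big_bdiagram2 (V : nmodType) n m (F : diagram -> diagram -> V) :
  \sum_(p : bdiagram n) \sum_(q : bdiagram m) F (bval p) (bval q) =
  \sum_(x <- [seq (p, q) | p <- dlist n, q <- dlist m]) F x.1 x.2.
Proof.
rewrite big_allpairs /= (big_bdiagram n (fun p => \sum_(q : bdiagram m) F p (bval q))).
by apply: eq_bigr => p _; rewrite big_bdiagram.
Qed.

Lemma pairs_uniq n m : uniq [seq (p, q) | p <- dlist n, q <- dlist m].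
Proof.
by apply: allpairs_uniq; rewrite ?dlist_uniq // => -[? ?] [? ?] _ _ [-> ->].
Qed.

Lemma mem_pairs n m x :
  (x \in [seq (p, q) | p <- dlist n, q <- dlist m]) =
  (order x.1 <= n)%N && (order x.2 <= m)%N.
Proof.
case: x => p q; rewrite -!mem_dlist.
by apply/allpairsP/andP => [[[a b] /= [ha hb [-> ->]]] //|[hp hq]]; exists (p, q).
Qed.

Lemma big_splits (V : nmodType) b s (F : diagram -> diagram -> V) :
  \sum_(p : bdiagram (order s)) \sum_(q : bdiagram (order s) | dop b (bval p) (bval q) == s)
    F (bval p) (bval q) = \sum_(x <- splits b s) F x.1 x.2.
Proof.
rewrite /splits big_filter [RHS]big_mkcond /=.
rewrite -(big_bdiagram2 _ _ (fun p q => if dop b p q == s then F p q else 0)).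
by apply: eq_bigr => p _; rewrite big_mkcond.
Qed.

(** Coassociativity of deconcatenation: both sides run once over each triple with product s. *)
Lemma big_splitsA (V : nmodType) b s (F : diagram -> diagram -> diagram -> V) :
  \sum_(x <- splits b s) \sum_(y <- splits b x.2) F x.1 y.1 y.2 =
  \sum_(x <- splits b s) \sum_(y <- splits b x.1) F y.1 y.2 x.2.
Proof.
pose l := [seq (x.1, y.1, y.2) | x <- splits b s, y <- splits b x.2].
pose r := [seq (y.1, y.2, x.2) | x <- splits b s, y <- splits b x.1].
transitivity (\sum_(z <- l) F z.1.1 z.1.2 z.2); first by rewrite big_allpairs_dep.
transitivity (\sum_(z <- r) F z.1.1 z.1.2 z.2); last by rewrite big_allpairs_dep.
apply/perm_big/uniq_perm.
(* A triple determines x and y, since x.2 is the product of the entries of y. *)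
- apply: allpairs_uniq_dep; [exact: splits_uniq|by move=> x _; exact: splits_uniq|].
  move=> [[x1 x2] y] [[x1' x2'] y'] /allpairsPdep[u [v [_ + [e1 e2]]]].
  rewrite -{}e1 -{}e2 mem_splits => /eqP /= e.
  move=> /allpairsPdep[u' [v' [_ + [e1 e2]]]].
  rewrite -{}e1 -{}e2 mem_splits => /eqP /= e'.
  case: y y' e e' => [y1 y2] [y1' y2'] /= <- <- [-> e1 e2].
  by rewrite {}e1 {}e2.
- apply: allpairs_uniq_dep; [exact: splits_uniq|by move=> x _; exact: splits_uniq|].
  move=> [[x1 x2] y] [[x1' x2'] y'] /allpairsPdep[u [v [_ + [e1 e2]]]].
  rewrite -{}e1 -{}e2 mem_splits => /eqP /= e.
  move=> /allpairsPdep[u' [v' [_ + [e1 e2]]]].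
  rewrite -{}e1 -{}e2 mem_splits => /eqP /= e'.
  case: y y' e e' => [y1 y2] [y1' y2'] /= <- <- [e1 e2 ->].
  by rewrite {}e1 {}e2.
- move=> [[p q] t]; apply/allpairsPdep/allpairsPdep.
  + move=> [x [y [+ + [-> -> ->]]]]; rewrite !mem_splits => /eqP hx /eqP hy.
    exists (dop b x.1 y.1, y.2), (x.1, y.1); rewrite !mem_splits /= -dopA_same hy.
    by rewrite hx !eqxx.
  + move=> [x [y [+ + [-> -> ->]]]]; rewrite !mem_splits => /eqP hx /eqP hy.
    exists (y.1, dop b y.2 x.2), (y.2, x.2); rewrite !mem_splits /= dopA_same hy.
    by rewrite hx !eqxx.
Qed.

(** * Linear extension and subspaces *)

Section Lext.
Variables (K : fieldType) (B : choiceType) (V : lmodType K).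

(** Linearity compares three elements with different supports; a common list r puts their sums on
    the same index set. *)
Lemma lextEw (f : B -> V) (r : seq B) (u : {malg K[B]}) :
  uniq r -> {subset msupp u <= r} -> lext f u = \sum_(b <- r) u@_b *: f b.
Proof.
move=> ur sub; apply: big_uniq_supp; rewrite ?fset_uniq // => b hb.
  by rewrite sub.
by move/mcoeff_outdom => ->; rewrite scale0r.
Qed.

Lemma lext_is_linear (f : B -> V) : linear (lext f).
Proof.
move=> a u v; pose r := undup (msupp u ++ msupp v).
have ur : uniq r by exact: undup_uniq.
have su : {subset msupp u <= r} by move=> x hx; rewrite mem_undup mem_cat hx.
have sv : {subset msupp v <= r} by move=> x hx; rewrite mem_undup mem_cat hx orbT.
rewrite !(lextEw _ ur) //; last first.
  move=> x; rewrite -mcoeff_neq0 mcoeffD mcoeffZ; apply: contraR.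
  rewrite mem_undup mem_cat negb_or => /andP[/mcoeff_outdom -> /mcoeff_outdom ->].
  by rewrite mulr0 addr0.
rewrite scaler_sumr -big_split; apply: eq_bigr => b _ /=.
by rewrite mcoeffD mcoeffZ scalerDl scalerA.
Qed.

HB.instance Definition _ (f : B -> V) :=
  GRing.isLinear.Build K {malg K[B]} V *:%R (lext f) (lext_is_linear f).

Lemma lextU (f : B -> V) b : lext f << b >> = f b.
Proof. by rewrite /lext msuppU oner_eq0 big_seq_fset1 mcoeffUU scale1r. Qed.

Lemma malgUZ (c : K) (b : B) : << c *g b >> = c *: << b >>.
Proof. by apply/malgP => k; rewrite mcoeffZ !mcoeffU mulrnAr mulr1. Qed.

Lemma malg_basis (u : {malg K[B]}) : u = \sum_(b <- msupp u) u@_b *: << b >>.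
Proof. by rewrite {1}[u]monalgE; apply: eq_bigr => b _; rewrite malgUZ. Qed.

Lemma linear_basis (f : {linear {malg K[B]} -> V}) u :
  f u = \sum_(b <- msupp u) u@_b *: f << b >>.
Proof. by rewrite {1}[u]malg_basis linear_sum; apply: eq_bigr => b _; rewrite linearZ. Qed.

End Lext.

Section Subspaces.
Variables (K : fieldType) (V : lmodType K) (W : V -> Prop).
Hypothesis hW : subspace W.

Lemma subspaceZ a x : W x -> W (a *: x).
Proof. by case: hW => h0 h hx; rewrite -[_ *: _]addr0; apply: h. Qed.

Lemma subspaceD x y : W x -> W y -> W (x + y).
Proof. by case: hW => h0 h hx hy; rewrite -[x]scale1r; apply: h. Qed.

Lemma subspaceB x y : W x -> W y -> W (x - y).
Proof.
by move=> hx hy; apply: subspaceD => //; rewrite -scaleN1r; apply: subspaceZ.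
Qed.

Lemma subspace_sum (I : eqType) (r : seq I) (P : pred I) (F : I -> V) :
  (forall i, i \in r -> P i -> W (F i)) -> W (\sum_(i <- r | P i) F i).
Proof.
move=> h; rewrite big_seq_cond; apply: big_rec => [|i x /andP[ir Pi] hx].
  by case: hW.
by apply: subspaceD => //; apply: h.
Qed.

Lemma subspace_span (X : V -> Prop) : incl X W -> incl (span X) W.
Proof.
move=> h x [s [hs ->]]; apply: subspace_sum => c cs _.
by apply/subspaceZ/h/hs.
Qed.

End Subspaces.

Lemma span_subspace (K : fieldType) (V : lmodType K) (X : V -> Prop) :
  subspace (span X).
Proof.
split; first by exists [::]; rewrite big_nil; split.
move=> a x y [s [hs ->]] [t [ht ->]].
exists ([seq (a * c.1, c.2) | c <- s] ++ t); split.
  move=> c; rewrite mem_cat => /orP[/mapP[d ds ->]|]; [exact: hs ds|exact: ht].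
rewrite big_cat big_map scaler_sumr /=; congr (_ + _).
by apply: eq_bigr => c _; rewrite scalerA.
Qed.

Lemma span_gen (K : fieldType) (V : lmodType K) (X : V -> Prop) x : X x -> span X x.
Proof.
move=> hx; exists [:: (1, x)]; rewrite big_seq1 scale1r; split => // c.
by rewrite inE => /eqP ->.
Qed.

Lemma tenssp_subspace (K : fieldType) (B C : choiceType)
    (U : {malg K[B]} -> Prop) (W : {malg K[C]} -> Prop) : subspace (tenssp U W).
Proof. exact: span_subspace. Qed.

Lemma addsp_subspace (K : fieldType) (V : lmodType K) (U W : V -> Prop) :
  subspace U -> subspace W -> subspace (addsp U W).
Proof.
move=> [u0 hu] [w0 hw]; split; first by exists 0, 0; rewrite addr0; split.
move=> a x y [x1 [x2 [hx1 hx2 ->]]] [y1 [y2 [hy1 hy2 ->]]].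
exists (a *: x1 + y1), (a *: x2 + y2); split; [exact: hu|exact: hw|].
by rewrite scalerDr addrACA.
Qed.

Lemma sumsp_subspace (K : fieldType) (V : lmodType K) n (W : 'I_n -> V -> Prop) :
  (forall i, subspace (W i)) -> subspace (sumsp W).
Proof.
move=> hW; split.
  by exists (fun=> 0); rewrite big1 //; split => // i; case: (hW i).
move=> a x y [x' [hx ->]] [y' [hy ->]].
exists (fun i => a *: x' i + y' i); split; first by move=> i; apply: (hW i).2.
by rewrite scaler_sumr -big_split.
Qed.

Lemma sumsp_in (K : fieldType) (V : lmodType K) n (W : 'I_n -> V -> Prop) i x :
  (forall i, subspace (W i)) -> W i x -> sumsp W x.
Proof.
move=> hW hx; exists (fun j => if j == i then x else 0); split.
  by move=> j; case: eqP => [->//|_]; case: (hW j).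
by rewrite -big_mkcond big_pred1_eq.
Qed.

(** * Subspaces cut out by a condition on the support *)

Section Supp.
Variable K : fieldType.

Definition suppin (B : choiceType) (Y : B -> Prop) (u : {malg K[B]}) : Prop :=
  forall b, b \in msupp u -> Y b.

Lemma suppin_subspace (B : choiceType) (Y : B -> Prop) : subspace (suppin Y).
Proof.
split; first by move=> b; rewrite msupp0.
move=> a x y hx hy b /(fsubsetP (msuppD_le _ _)); rewrite in_fsetU.
by case/orP => [/(fsubsetP (msuppZ_le _ _))/hx|/hy].
Qed.

Lemma suppinU (B : choiceType) (Y : B -> Prop) b : Y b -> suppin Y << b >>.
Proof. by move=> hb x; rewrite msuppU oner_eq0 inE => /eqP ->. Qed.

Lemma suppinW (B : choiceType) (Y Z : B -> Prop) u :
  (forall b, Y b -> Z b) -> suppin Y u -> suppin Z u.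
Proof. by move=> h hu b /hu/h. Qed.

Lemma subspace_suppin (B : choiceType) (Y : B -> Prop) (W : {malg K[B]} -> Prop) :
  subspace W -> (forall b, Y b -> W << b >>) -> incl (suppin Y) W.
Proof.
move=> hW h u hu; rewrite [u]malg_basis; apply: subspace_sum => // b bu _.
by apply: subspaceZ => //; apply/h/hu.
Qed.

Lemma filtE (X : nat -> diagram -> Prop) n x :
  filt K X n x <-> suppin (fun p => exists2 i, (i <= n)%N & X i p) x.
Proof.
split.
  apply: subspace_span; first exact: suppin_subspace.
  by move=> _ [i [p [le_in hp ->]]]; apply: suppinU; exists i.
apply: subspace_suppin; first exact: span_subspace.
by move=> p [i le_in hp]; apply: span_gen; exists i, p.
Qed.

Lemma tensE (B C : choiceType) (u : {malg K[B]}) (v : {malg K[C]}) x :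
  (tens u v)@_x = u@_x.1 * v@_x.2.
Proof.
case: x => b c /=; rewrite /tens raddf_sum /=.
transitivity (\sum_(b' <- msupp u) if b' == b then u@_b * v@_c else 0).
  apply: eq_bigr => b' _; rewrite raddf_sum /=.
  have [->|nb] := eqVneq b' b; last first.
    by rewrite big1 // => c' _; rewrite mcoeffU xpair_eqE (negbTE nb).
  case: (boolP (c \in msupp v)) => hc.
    rewrite (@big_uniq_only _ _ _ _ c) ?fset_uniq ?mcoeffUU //.
    by move=> c' _ nc; rewrite mcoeffU xpair_eqE (negbTE nc) andbF.
  rewrite big_seq big1 ?(mcoeff_outdom hc) ?mulr0 // => c' hc'.
  have /negbTE nc : c' != c by apply: contraNneq hc => <-.
  by rewrite mcoeffU xpair_eqE nc andbF.
case: (boolP (b \in msupp u)) => hb.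
  by rewrite (@big_uniq_only _ _ _ _ b) ?fset_uniq ?eqxx // => b' _ /negbTE ->.
rewrite (mcoeff_outdom hb) mul0r big_seq big1 // => b' hb'.
have /negbTE -> // : b' != b by apply: contraNneq hb => <-.
Qed.

Lemma tensUU (B C : choiceType) (b : B) (c : C) :
  tens << b >> << c >> = << (b, c) >> :> {malg K[_]}.
Proof.
apply/malgP => -[b' c']; rewrite tensE !mcoeffU xpair_eqE.
by rewrite -natrM mulnb.
Qed.

(** Lets membership in a tensor product be tested on pairs of diagrams, both for the failure in
    ParSym and for the coradical filtration. *)
Lemma tenssp_suppin (B C : choiceType) (Y : B -> Prop) (Z : C -> Prop) t :
  tenssp (suppin Y) (suppin Z) t <-> suppin (fun x => Y x.1 /\ Z x.2) t.
Proof.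
split.
  apply: subspace_span; first exact: suppin_subspace.
  move=> _ [u [w [hu hw ->]]] x; rewrite -mcoeff_neq0 tensE mulf_eq0 negb_or.
  by rewrite !mcoeff_neq0 => /andP[/hu ? /hw].
apply: subspace_suppin; first exact: span_subspace.
move=> [b c] [/= hb hc]; apply: span_gen; exists << b >>, << c >>.
by rewrite tensUU; split => //; apply: suppinU.
Qed.

Lemma tenssp_incl (B C : choiceType) (U U' : {malg K[B]} -> Prop)
    (W W' : {malg K[C]} -> Prop) :
  incl U U' -> incl W W' -> incl (tenssp U W) (tenssp U' W').
Proof.
move=> hU hW; apply: subspace_span; first exact: tenssp_subspace.
move=> _ [u [w [hu hw ->]]]; apply: span_gen; exists u, w.
by split; [apply: hU|apply: hW|].
Qed.

End Supp.

(** * Filtrations of a Hopf algebra spanned by diagrams *)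

Section DiagramHopf.
Variables (K : fieldType) (H : hopf_ops K diagram).
Variable cm : diagram -> {malg K[(diagram * diagram)%type]}.
Local Notation A := {malg K[diagram]}.
(** [hopf_ops] carries no axioms; the hypotheses of this section are facts later proved for both
    ParSym and ParQSym, with [cm] the coproduct on the basis. *)
Hypothesis hmul_bilin : forall u v : A,
  hmul H u v = lext (fun b => lext (fun c => hmul H << b >> << c >>) v) u.
Hypothesis hcomulE : hcomul H =1 lext cm.
Hypothesis honeE : hone H = << dempty >>.
Hypothesis hcounitE : forall u, hcounit H u = u@_dempty.

Lemma hmul_tens_tens (u v : A) : hmul_tens H (tens u v) = hmul H u v.
Proof.
rewrite hmul_bilin /tens /hmul_tens linear_sum; apply: eq_bigr => b _ /=.
rewrite linear_sum /lext scaler_sumr; apply: eq_bigr => c _ /=.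
by rewrite malgUZ linearZ /= lextU scalerA.
Qed.

Lemma hmul_suppin (Y Z T : diagram -> Prop) (u v : A) :
  suppin Y u -> suppin Z v ->
  (forall a b, Y a -> Z b -> suppin T (hmul H << a >> << b >>)) ->
  suppin T (hmul H u v).
Proof.
move=> hu hv h; rewrite hmul_bilin.
apply: (subspace_sum (suppin_subspace _ _)) => a ha _.
apply: (subspaceZ (suppin_subspace _ _)).
apply: (subspace_sum (suppin_subspace _ _)) => b hb _.
apply: (subspaceZ (suppin_subspace _ _)).
exact: h (hu a ha) (hv b hb).
Qed.

(** The convolution product of f and g is this map after the coproduct. *)
Definition conv (f g : {linear A -> A}) (t : {malg K[(diagram * diagram)%type]}) : A :=
  hmul_tens H (tensmap f g t).

Lemma conv_is_linear f g : linear (conv f g).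
Proof. by move=> a t u; rewrite /conv /tensmap linearP /hmul_tens linearP. Qed.

HB.instance Definition _ f g :=
  GRing.isLinear.Build K _ A *:%R (conv f g) (conv_is_linear f g).

Lemma conv_basis (f g : {linear A -> A}) x :
  conv f g << x >> = hmul H (f << x.1 >>) (g << x.2 >>).
Proof. by rewrite /conv /tensmap lextU hmul_tens_tens. Qed.

Lemma convE (f g : {linear A -> A}) t :
  conv f g t = \sum_(x <- msupp t) t@_x *: hmul H (f << x.1 >>) (g << x.2 >>).
Proof. by rewrite linear_basis; apply: eq_bigr => x _; rewrite -conv_basis. Qed.

Lemma conv_ext (f g : {linear A -> A}) :
  (forall p, conv f g (cm p) = (p == dempty)%:R *: << dempty >>) ->
  forall x, hmul_tens H (tensmap f g (hcomul H x)) = hcounit H x *: hone H.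
Proof.
move=> h x; rewrite hcomulE hcounitE honeE -/(conv f g _).
rewrite [in RHS](malg_basis x) [X in X *: _]raddf_sum scaler_suml [lext cm x]/lext linear_sum.
by apply: eq_bigr => p _; rewrite linearZ /= mcoeffZ mcoeffU -scalerA -h.
Qed.

Hypothesis hmul1 : forall u, hmul H u << dempty >> = u.
Hypothesis cm_counit : forall p a, (cm p)@_(a, dempty) = (a == p)%:R.
Hypothesis cm_order : forall p x, x \in msupp (cm p) ->
  (order x.1 + order x.2)%N = order p.

(* S(p) is minus a sum of products S(a)b with a of smaller order, so S inherits
   every grading-like property of the product and coproduct. *)
Lemma antipode_supp (S : {linear A -> A}) (Y : nat -> diagram -> Prop) :
  (forall x, hmul_tens H (tensmap S idfun (hcomul H x)) = hcounit H x *: hone H) ->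
  (forall n p x, Y n p -> x \in msupp (cm p) ->
     exists i j, [/\ (i + j)%N = n, Y i x.1 & Y j x.2]) ->
  (forall n m p q, Y n p -> Y m q -> suppin (Y (n + m)%N) (hmul H << p >> << q >>)) ->
  forall n p, Y n p -> suppin (Y n) (S << p >>).
Proof.
move=> hS hc hm n p; have [k] := ubnP (order p).
elim: k n p => // k IH n p; rewrite ltnS => le_pk hp.
have := hS << p >>; rewrite hcomulE lextU -/(conv _ _ _) convE.
(* This term of the coproduct has coefficient 1 and contributes S(p) itself; the antipode identity
   is solved for it. *)
have hin : (p, dempty) \in msupp (cm p).
  by rewrite -mcoeff_neq0 cm_counit eqxx oner_eq0.
have e1 : (cm p)@_(p, dempty) *: hmul H (S << p >>) (idfun << dempty >>) = S << p >>.
  by rewrite cm_counit eqxx scale1r [LHS]hmul1.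
rewrite (big_fsetD1 (p, dempty) hin) [X in X + _ = _]e1 => /(canRL (addrK _)) ->.
apply: (subspaceB (suppin_subspace _ _)).
  (* The counit term is non-zero only for empty p, and then [Y n p] is the claim. *)
  rewrite hcounitE honeE mcoeffU; case: eqP => [<-|_].
    by rewrite scale1r; apply: suppinU.
  by rewrite scale0r; case: (suppin_subspace K (Y n)).
apply: (subspace_sum (suppin_subspace _ _)) => x.
rewrite in_fsetD1 => /andP[nx hx] _; apply: (subspaceZ (suppin_subspace _ _)).
have [i [j [eij hi hj]]] := hc _ _ _ hp hx.
(* If x.2 were empty, [cm_counit] would make x the term already removed. *)
have lt : (order x.1 < k)%N.
  apply: leq_trans le_pk; rewrite -(cm_order hx) -addn1 leq_add2l lt0n order_eq0.
  apply: contraNneq nx => x2; case: x x2 hx {hi hj} => a b /= ->.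
  by rewrite -mcoeff_neq0 cm_counit; case: (eqVneq a p) => [->|_] //; rewrite eqxx.
rewrite -eij; apply: (hmul_suppin (Y := Y i) (Z := Y j)).
- exact: (IH i x.1).
- exact: suppinU.
- by move=> a b; apply: hm.
Qed.

Section Filtration.
Variable X : nat -> diagram -> Prop.
Hypothesis X_total : forall p, exists n, X n p.

Let D n p := exists2 i, (i <= n)%N & X i p.

Lemma D_leq n m p : (n <= m)%N -> D n p -> D m p.
Proof. by move=> le_nm [i le_in hi]; exists i => //; apply: leq_trans le_nm. Qed.

Lemma filt_subspace n : subspace (filt K X n).
Proof. exact: span_subspace. Qed.

Lemma filt_filtration : filtration (filt K X).
Proof.
split; first exact: filt_subspace.
  by move=> n x /filtE hx; apply/filtE => p /hx; apply: D_leq.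
move=> x; rewrite [x]malg_basis.
elim: (msupp x : seq _) => [|p s [n IH]].
  by exists 0; rewrite big_nil; case: (filt_subspace 0).
have [m hm] := X_total p; exists (maxn n m); rewrite big_cons.
apply: (subspaceD (filt_subspace _)).
  apply: (subspaceZ (filt_subspace _)).
  by apply/filtE; apply: suppinU; exists m; rewrite ?leq_maxr.
by move/filtE in IH; apply/filtE => q /IH; apply: D_leq; rewrite leq_maxl.
Qed.

Hypothesis X_mul : forall n m p q, X n p -> X m q ->
  suppin (D (n + m)%N) (hmul H << p >> << q >>).

Lemma D_mul n m p q : D n p -> D m q -> suppin (D (n + m)%N) (hmul H << p >> << q >>).
Proof.
move=> [i le_in hi] [j le_jm hj] r /(X_mul hi hj); apply: D_leq.
exact: leq_add.
Qed.

Lemma filt_algebra : algebra_filtration H (filt K X).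
Proof.
split; first exact: filt_filtration.
move=> n m x y /filtE hx /filtE hy; apply/filtE; apply: (hmul_suppin hx hy).
by move=> p q; apply: D_mul.
Qed.

Hypothesis X_comul : forall n p x, X n p -> x \in msupp (cm p) ->
  exists i j, [/\ (i + j)%N = n, X i x.1 & X j x.2].

Lemma D_comul n p x : D n p -> x \in msupp (cm p) ->
  exists i j, [/\ (i + j)%N = n, D i x.1 & D j x.2].
Proof.
move=> [m le_mn hm] hx; have [i [j [eij hi hj]]] := X_comul hm hx.
have le_in : (i <= n)%N by apply: leq_trans le_mn; rewrite -eij leq_addr.
(* Here i + j = m, and the slack n - m goes to the second index. *)
exists i, (n - i)%N; rewrite subnKC //; split => //; first by exists i.
by exists j => //; rewrite leq_subRL // eij.
Qed.

Lemma filt_coalgebra : coalgebra_filtration H (filt K X).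
Proof.
split; first exact: filt_filtration.
move=> n x /filtE hx; rewrite hcomulE.
have hW (i : 'I_n.+1) : subspace (tenssp (filt K X i) (filt K X (n - i)%N)).
  exact: tenssp_subspace.
apply: (subspace_sum (sumsp_subspace hW)) => p hp _.
apply: (subspaceZ (sumsp_subspace hW)).
apply: (@subspace_suppin _ _ (fun y => y \in msupp (cm p))) => // [|y hy].
  exact: sumsp_subspace.
have [i [j [eij hi hj]]] := D_comul (hx _ hp) hy.
have lt_in : (i < n.+1)%N by rewrite ltnS -eij leq_addr.
apply: (@sumsp_in _ _ _ _ (Ordinal lt_in)) => //=.
apply: span_gen; exists << y.1 >>, << y.2 >>.
have -> : (n - i)%N = j by rewrite -eij addKn.
rewrite tensUU -surjective_pairing; split => //; apply/filtE.
  by apply: suppinU; exact: hi.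
by apply: suppinU; exact: hj.
Qed.

Lemma filt_hopf : (exists S, is_antipode H S) -> hopf_filtration H (filt K X).
Proof.
move=> hS; split => //; [exact: filt_coalgebra|exact: filt_algebra|].
move=> S [hl _] n x /filtE hx; apply/filtE.
rewrite linear_basis; apply: (subspace_sum (suppin_subspace _ _)) => p hp _.
apply: (subspaceZ (suppin_subspace _ _)).
apply: (@antipode_supp S D) => //; [exact: D_comul|exact: D_mul|exact: hx].
Qed.

End Filtration.
End DiagramHopf.

(* Otherwise trivial goals on lengths make the tactics evaluate xchoose. *)
Local Opaque dlength tfactors.

(** * The coproduct of ParSym *)

Lemma diagram_ind_irr (P : diagram -> Prop) :
  P dempty ->
  (forall s p, s != dempty -> tens_irr s -> P p -> P (dtens s p)) ->
  forall p, P p.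
Proof.
move=> P0 Pc p; rewrite -(tword_tfactors p).
elim: (tfactors p) (irrword_tfactors p) => [_|s w IH /andP[/andP[s0 hs] hw]].
  by rewrite /tword big_nil.
by rewrite tword_cons; apply: Pc => //; apply: IH.
Qed.

(** In the right antipode identity the cancellation takes place at the last factor, hence this
    mirrored induction. *)
Lemma diagram_ind_irr_r (P : diagram -> Prop) :
  P dempty ->
  (forall p s, s != dempty -> tens_irr s -> P p -> P (dtens p s)) ->
  forall p, P p.
Proof.
move=> P0 Pc p; rewrite -(tword_tfactors p).
elim/last_ind: (tfactors p) (irrword_tfactors p) => [_|w s IH].
  by rewrite /tword big_nil.
rewrite /irrword all_rcons => /andP[/andP[s0 hs] hw].
rewrite -cats1 tword_cat tword_cons {2}/tword big_nil dtensp1.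
by apply: Pc => //; apply: IH.
Qed.

(** A degree is a relation here, not a function, because [Iset] is given by an existential. *)
Record additive_degree (X : nat -> diagram -> Prop) : Prop := AdditiveDegree {
  degree_total : forall p, exists n, X n p;
  degree_inj : forall n m p, X n p -> X m p -> n = m;
  degree_dop : forall b n m p q, X n p -> X m q -> X (n + m)%N (dop b p q)
}.

Lemma Aset_additive : additive_degree Aset.
Proof.
split; rewrite /Aset; first by move=> p; exists (order p).
  by move=> n m p -> ->.
by move=> b n m p q <- <-; rewrite order_dop.
Qed.

Lemma Iset_additive : additive_degree Iset.
Proof. by split; [exact: Iset_exists|exact: Iset_inj|exact: Iset_dop]. Qed.

(** The factors have some degrees i and j; additivity and uniqueness force i + j = n. *)
Lemma degree_split X b n p q : additive_degree X -> X n (dop b p q) ->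
  exists i j, [/\ (i + j)%N = n, X i p & X j q].
Proof.
move=> hX h; have [i hi] := degree_total hX p; have [j hj] := degree_total hX q.
by exists i, j; split => //; apply: (degree_inj hX _ h); apply: degree_dop.
Qed.

Lemma degree0 X : additive_degree X -> X 0 dempty.
Proof.
move=> hX; have [n hn] := degree_total hX dempty.
have := degree_dop hX false hn hn; rewrite dop1p => /(degree_inj hX hn).
by move/eqP; rewrite -[X in X == _]addn0 eqn_add2l => /eqP n0; rewrite -n0 in hn.
Qed.

Section MalgMonoid.
Variables (K : fieldType) (M : monomType).
Implicit Types (x y z : M) (u v : {malg K[M]}).

Lemma malgUM x y : << x >> * << y >> = << mmul x y >> :> {malg K[M]}.
Proof. by rewrite malgM_def fgmulUU mulr1. Qed.

(** Scalars sit at the unit monomial, so they are central although the monoid is not commutative. *)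
Lemma malg_scalerAr (c : K) u v : u * (c *: v) = c *: (u * v).
Proof.
have E w : w * c%:MP = c%:MP * w :> {malg K[M]}.
  rewrite !malgM_def fgmulUg fgmulgU; apply: eq_bigr => k _.
  by rewrite mulm1 mul1m mulrC.
by rewrite -!mul_malgC mulrA E mulrA.
Qed.

Lemma mcoeffUM x v z :
  (<< x >> * v)@_z = \sum_(y <- msupp v | mmul x y == z) v@_y.
Proof.
rewrite malgM_def fgmulUg raddf_sum [RHS]big_mkcond; apply: eq_bigr => y _ /=.
by rewrite mcoeffU mul1r mulrb.
Qed.

(** The uniqueness premise is supplied later by cancellation of irreducible first factors. *)
Lemma mcoeffUM_in x v z y0 : (forall y, mmul x y = z -> y = y0) ->
  mmul x y0 = z -> (<< x >> * v)@_z = v@_y0.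
Proof.
move=> h e; rewrite mcoeffUM big_mkcond /=.
case: (boolP (y0 \in msupp v)) => hy.
  rewrite (@big_uniq_only _ _ _ _ y0) ?fset_uniq ?e ?eqxx //.
  by move=> y _ /eqP ny; case: eqP => // /h.
rewrite (mcoeff_outdom hy) big_seq big1 // => y hy'.
by case: eqP => // /h ey; rewrite -ey hy' in hy.
Qed.

Lemma mcoeffUM_out x v z : (forall y, y \in msupp v -> mmul x y <> z) ->
  (<< x >> * v)@_z = 0.
Proof.
move=> h; rewrite mcoeffUM big_seq_cond big1 // => y /andP[hy /eqP e].
by case: (h y hy).
Qed.

End MalgMonoid.

Section PSymComul.
Variable K : fieldType.
Local Notation A := {malg K[diagram]}.
Local Notation A2 := {malg K[(diagram * diagram)%type]}.

Definition psym_comul (p : diagram) : A2 :=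
  \prod_(s <- tfactors p) psym_comul_irr K s.

(** By [tens_irr_dbul_inv] the two halves of an irreducible s are irreducible automatically. *)
Lemma psym_comul_irrE s : tens_irr s ->
  psym_comul_irr K s = \sum_(x <- splits true s) << x >>.
Proof.
move=> hs; under eq_bigr do rewrite [x in << x >>]surjective_pairing.
rewrite -(big_splits true s (fun p q => << (p, q) >>)) /psym_comul_irr.
apply: eq_bigr => p _; apply: eq_bigl => q.
rewrite /dop; case: eqP => [e|]; last by rewrite !andbF.
by rewrite !andbT; apply: tens_irr_dbul_inv; rewrite e.
Qed.

Lemma psym_comul_dtens p q : psym_comul (dtens p q) = psym_comul p * psym_comul q.
Proof. by rewrite /psym_comul tfactors_dtens big_cat. Qed.

Lemma psym_comul_irr1 s : s != dempty -> tens_irr s ->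
  psym_comul s = \sum_(x <- splits true s) << x >>.
Proof. by move=> s0 hs; rewrite /psym_comul tfactors_irr // big_seq1 psym_comul_irrE. Qed.

Lemma psym_comul0 : psym_comul dempty = << (dempty, dempty) >>.
Proof. by rewrite /psym_comul tfactors0 big_nil. Qed.

Lemma msupp_splits b s x :
  x \in msupp (\sum_(x <- splits b s) << x >> : A2) -> x \in splits b s.
Proof.
apply: (@subspace_sum K _ (suppin (fun x => x \in splits b s))).
  exact: suppin_subspace.
by move=> y hy _; apply: suppinU.
Qed.

(** A pair in the support arises by splitting every tensor factor with \bullet and tensoring the
    left and the right halves. *)
Lemma psym_comul_ind (P : diagram -> diagram * diagram -> Prop) :
  P dempty (dempty, dempty) ->
  (forall s p x y, s != dempty -> tens_irr s -> dbul x.1 x.2 = s -> P p y ->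
     P (dtens s p) (dtens x.1 y.1, dtens x.2 y.2)) ->
  forall p x, x \in msupp (psym_comul p) -> P p x.
Proof.
move=> P0 Pc; apply: diagram_ind_irr => [x|s p s0 hs IH x].
  by rewrite psym_comul0 msuppU oner_eq0 inE => /eqP ->.
rewrite psym_comul_dtens psym_comul_irr1 //.
case/msuppM_le => y [z [/msupp_splits hy hz ->]].
move: hy; rewrite mem_splits => /eqP hy.
by apply: Pc => //; apply: IH.
Qed.

Lemma psym_comul_degree X n p x : additive_degree X ->
  X n p -> x \in msupp (psym_comul p) ->
  exists i j, [/\ (i + j)%N = n, X i x.1 & X j x.2].
Proof.
move=> hX hp hx; elim/psym_comul_ind: hx n hp => {p x}.
  move=> n hn; exists 0, 0; have h0 := degree0 hX.
  by split => //; apply: (degree_inj hX h0).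
move=> s p x y s0 hs e IH n hsp.
have [i [j [<- hi hj]]] := @degree_split X false n s p hX hsp.
rewrite -e in hi; have [i1 [i2 [<- h1 h2]]] := @degree_split X true i _ _ hX hi.
have [j1 [j2 [<- h3 h4]]] := IH j hj.
exists (i1 + j1)%N, (i2 + j2)%N; split; first by rewrite addnACA.
  exact: (degree_dop hX false h1 h3).
exact: (degree_dop hX false h2 h4).
Qed.

Lemma psym_comul_order p x : x \in msupp (psym_comul p) ->
  (order x.1 + order x.2)%N = order p.
Proof.
by case/(psym_comul_degree Aset_additive (erefl _)) => i [j [<- <- <-]].
Qed.

(** Of the two halves of a tensor factor at least one is non-empty, so each factor of p leaves at
    least one factor in the pair. *)
Lemma psym_comul_dlength p x : x \in msupp (psym_comul p) ->
  (dlength p <= dlength x.1 + dlength x.2)%N.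
Proof.
move: p x; apply: psym_comul_ind => [|s p x y s0 hs e IH]; first by rewrite dlength0.
rewrite [(_, _).1]/= [(_, _).2]/= !dlength_dtens addnACA.
apply: leq_add; last exact: IH.
rewrite (dlength_irr s0 hs).
have h p' : p' != dempty -> (0 < dlength p')%N by rewrite -dlength_eq0 lt0n.
have [x1|/h x1] := eqVneq x.1 dempty; last exact: leq_trans x1 (leq_addr _ _).
have [x2|/h x2] := eqVneq x.2 dempty; last exact: leq_trans x2 (leq_addl _ _).
by case/eqP: s0; rewrite -e x1 x2; exact: (dop1p true).
Qed.

Lemma psym_comul_counit p a : (psym_comul p)@_(a, dempty) = (a == p)%:R.
Proof.
elim/diagram_ind_irr: p a => [a|s p s0 hs IH a].
  by rewrite psym_comul0 mcoeffU xpair_eqE eqxx andbT eq_sym.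
rewrite psym_comul_dtens psym_comul_irr1 // mulr_suml raddf_sum /=.
(* An empty second entry forces the trivial splitting of s; cancelling s then leads to the induction
   hypothesis. *)
rewrite (@big_uniq_only _ _ _ _ (s, dempty)) ?splits_uniq //; last 2 first.
- by rewrite mem_splits /= [dbul _ _](dopp1 true).
- move=> x; rewrite mem_splits => /eqP e nx; apply: mcoeffUM_out => y _ exy.
  have /dtens_eq1[x2 _] : dtens x.2 y.2 = dempty := congr1 snd exy.
  case/eqP: nx; rewrite [x]surjective_pairing x2.
  by rewrite -e x2 [dop _ _ _](dopp1 true).
have [->|na] := eqVneq a (dtens s p).
  rewrite (@mcoeffUM_in _ _ _ _ _ (p, dempty)) ?IH ?eqxx //.
    move=> [y1 y2] e.
    have [_ ->] := irr_dtens_inj s0 hs s0 hs (congr1 fst e : dtens s y1 = dtens s p).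
    by congr pair; have : dtens dempty y2 = dempty := congr1 snd e; rewrite dtens1p.
  by congr pair; exact: dtens1p.
apply: mcoeffUM_out => -[y1 y2] hy e.
have e1 : dtens s y1 = a := congr1 fst e.
have : dtens dempty y2 = dempty := congr1 snd e; rewrite dtens1p => e2.
move: hy na; rewrite e2 -mcoeff_neq0 IH -e1.
by case: (eqVneq y1 p) => [->|_]; rewrite eqxx.
Qed.

End PSymComul.

(** * The antipode of ParSym *)

Section ConvolutionInverse.
Variables (V : zmodType) (sp : diagram -> seq (diagram * diagram)).
Variables (act : V -> diagram -> V) (e : diagram -> V).
Hypothesis sp_lt : forall s x, x \in sp s -> x.2 != dempty -> (order x.1 < order s)%N.

(** The recursion descends along the order, so n is fuel; with n above the order of s the value 0 is
    never reached. [sp] and [act] are abstract so that left and right inverses are both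
    instances. *)
Fixpoint conv_inv_rec (n : nat) (s : diagram) : V :=
  if n is n'.+1 then
    e s - \sum_(x <- sp s | x.2 != dempty) act (conv_inv_rec n' x.1) x.2
  else 0.

Lemma conv_inv_rec_stable n m s : (order s < n)%N -> (order s < m)%N ->
  conv_inv_rec n s = conv_inv_rec m s.
Proof.
elim: n m s => // n IH [|m] // s; rewrite !ltnS => le_sn le_sm /=.
congr (_ - _); rewrite big_seq_cond [RHS]big_seq_cond; apply: eq_bigr => x /andP[hx x2].
have lt := sp_lt hx x2.
by rewrite (IH m) // (leq_trans lt).
Qed.

Lemma conv_inv_exists : exists f : diagram -> V,
  forall s, f s + \sum_(x <- sp s | x.2 != dempty) act (f x.1) x.2 = e s.
Proof.
exists (fun s => conv_inv_rec (order s).+1 s) => s.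
rewrite [X in X + _]/= -[RHS](subrK (\sum_(x <- sp s | x.2 != dempty)
  act (conv_inv_rec (order x.1).+1 x.1) x.2)); congr (_ - _ + _).
rewrite big_seq_cond [RHS]big_seq_cond; apply: eq_bigr => x /andP[hx x2].
by rewrite (@conv_inv_rec_stable _ (order x.1).+1) ?sp_lt.
Qed.

End ConvolutionInverse.

Section ParSymAntipode.
Variable K : fieldType.
Local Notation A := {malg K[diagram]}.
Local Notation A2 := {malg K[(diagram * diagram)%type]}.

Let eps (s : diagram) : A := (s == dempty)%:R.

Lemma splits_rec_r (V : zmodType) b s (F : diagram * diagram -> V) :
  \sum_(x <- splits b s) F x =
  F (s, dempty) + \sum_(x <- splits b s | x.2 != dempty) F x.
Proof.
rewrite (bigID (fun x => x.2 == dempty)) /=; congr (_ + _).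
rewrite -big_filter (@big_uniq_only _ _ _ _ (s, dempty)) ?(filter_uniq _ (splits_uniq _ _)) //.
  by rewrite mem_filter mem_splits eqxx dopp1 eqxx.
move=> [p q]; rewrite mem_filter mem_splits => /andP[/eqP /= ->].
by rewrite dopp1 => /eqP ->; rewrite eqxx.
Qed.

Lemma splits_rec_l (V : zmodType) b s (F : diagram * diagram -> V) :
  \sum_(x <- splits b s) F x =
  F (dempty, s) + \sum_(x <- splits b s | x.1 != dempty) F x.
Proof.
rewrite (bigID (fun x => x.1 == dempty)) /=; congr (_ + _).
rewrite -big_filter (@big_uniq_only _ _ _ _ (dempty, s)) ?(filter_uniq _ (splits_uniq _ _)) //.
  by rewrite mem_filter mem_splits eqxx dop1p eqxx.
move=> [p q]; rewrite mem_filter mem_splits => /andP[/eqP /= ->].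
by rewrite dop1p => /eqP ->; rewrite eqxx.
Qed.

(* Left and right inverses exist by recursion on the order; they coincide by
   associativity of dbul. *)
Lemma dbul_antipode_exists : exists f : diagram -> A,
  (forall s, \sum_(x <- splits true s) f x.1 * << x.2 >> = eps s) /\
  (forall s, \sum_(x <- splits true s) << x.1 >> * f x.2 = eps s).
Proof.
have [|f hf] := @conv_inv_exists A (splits true) (fun v p => v * << p >>) eps.
  move=> s x /splits_order <-; rewrite -order_eq0 -lt0n => x2.
  by rewrite -addn1 leq_add2l.
(* Swapping the halves turns the recursion on the first half into one on the second. *)
have [|g hg] := @conv_inv_exists A
    (fun s => [seq (x.2, x.1) | x <- splits true s]) (fun v p => << p >> * v) eps.
  move=> s _ /mapP[x /splits_order <- ->] /=; rewrite -order_eq0 -lt0n => x1.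
  by rewrite -add1n leq_add2r.
have hf' s : \sum_(x <- splits true s) f x.1 * << x.2 >> = eps s.
  by rewrite splits_rec_r -(hf s); congr (_ + _); exact: mulr1.
have hg' s : \sum_(x <- splits true s) << x.1 >> * g x.2 = eps s.
  rewrite splits_rec_l -(hg s) big_map; congr (_ + _); exact: mul1r.
exists f; split => // s; rewrite -(hg' s); apply: eq_bigr => -[p q] _ /=; congr (_ * _).
have E1 : \sum_(x <- splits true q) f x.1 * eps x.2 = f q.
  rewrite splits_rec_r /eps eqxx mulr1 big1 ?addr0 // => x /negbTE ->.
  by rewrite mulr0.
have E2 : \sum_(x <- splits true q) eps x.1 * g x.2 = g q.
  rewrite splits_rec_l /eps eqxx mul1r big1 ?addr0 // => x /negbTE ->.
  by rewrite mul0r.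
rewrite -E1 -E2.
(* This is the convolution of f, the identity and g: one bracketing collapses to f, the other to
   g. *)
transitivity (\sum_(x <- splits true q) \sum_(y <- splits true x.2)
    f x.1 * << y.1 >> * g y.2).
  apply: eq_bigr => x _; rewrite -(hg' x.2) mulr_sumr.
  by apply: eq_bigr => y _; rewrite mulrA.
rewrite (big_splitsA true q (fun a b c => f a * << b >> * g c)).
by apply: eq_bigr => x _; rewrite -(hf' x.1) mulr_suml.
Qed.

Lemma psym_bilin (u v : A) : hmul (ParSym K) u v =
  lext (fun b => lext (fun c => hmul (ParSym K) << b >> << c >>) v) u.
Proof.
rewrite /= malgME /lext; apply: eq_bigr => b _; rewrite scaler_sumr.
apply: eq_bigr => c _; rewrite malgUM scalerA.
by rewrite malgUZ.
Qed.

Lemma psym_comulE : hcomul (ParSym K) =1 lext (psym_comul K).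
Proof. by []. Qed.

Lemma psym_mul1 (u : A) : hmul (ParSym K) u << dempty >> = u.
Proof. exact: mulr1. Qed.

Section Antimorphism.
Variable f : diagram -> A.
Hypothesis f_left : forall s, \sum_(x <- splits true s) f x.1 * << x.2 >> = eps s.
Hypothesis f_right : forall s, \sum_(x <- splits true s) << x.1 >> * f x.2 = eps s.

Definition anti (p : diagram) : A := \prod_(s <- rev (tfactors p)) f s.

Lemma anti_dtens p q : anti (dtens p q) = anti q * anti p.
Proof. by rewrite /anti tfactors_dtens rev_cat big_cat. Qed.

Lemma anti0 : anti dempty = 1.
Proof. by rewrite /anti tfactors0 big_nil. Qed.

Lemma splits0 b : splits b dempty = [:: (dempty, dempty)].
Proof.
apply: perm_small_eq => //; apply: uniq_perm; rewrite ?splits_uniq // => -[p q].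
rewrite mem_splits inE; apply/eqP/eqP => [e|[-> ->]]; last exact: dop1p.
have := congr1 order e; rewrite order_dop => /eqP; rewrite addn_eq0 !order_eq0.
by case/andP => /eqP /= -> /eqP ->.
Qed.

Lemma anti_irr s : tens_irr s -> anti s = f s.
Proof.
move=> hs; have [->|s0] := eqVneq s dempty; last first.
  by rewrite /anti tfactors_irr // big_seq1.
(* At the empty diagram, [f_left] reads [f dempty = 1]. *)
by rewrite anti0; have := f_left dempty; rewrite splits0 big_seq1 [_ * _]mulr1 /eps eqxx.
Qed.

Lemma splits_irr s x : tens_irr s -> x \in splits true s -> tens_irr x.1 && tens_irr x.2.
Proof.
move=> hs; rewrite mem_splits => /eqP e.
by apply: tens_irr_dbul_inv; rewrite [dbul _ _]e.
Qed.

Let S := lext anti : {linear A -> A}.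

(** Each term (a, b) of the coproduct of the remaining factors contributes [anti a], then the
    convolution sum of s, then b; the middle sum is zero because s is non-empty. *)
Lemma anti_left p :
  conv (ParSym K) S idfun (psym_comul K p) = (p == dempty)%:R *: << dempty >>.
Proof.
elim/diagram_ind_irr: p => [|s p s0 hs _].
  rewrite psym_comul0 (conv_basis psym_bilin) eqxx scale1r.
  by rewrite [S _]lextU anti0 [LHS]mul1r.
rewrite psym_comul_dtens; move: (psym_comul K p) => Y.
have -> : (dtens s p == dempty) = false by rewrite (negbTE (dop_neq0 false _ s0)).
rewrite scale0r {1}[Y]malg_basis mulr_sumr linear_sum.
rewrite big1 // => -[a b] _.
rewrite malg_scalerAr linearZ /=; apply/eqP; rewrite scaler_eq0; apply/orP; right; apply/eqP.
rewrite psym_comul_irr1 // mulr_suml linear_sum /=.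
transitivity (anti a * (\sum_(x <- splits true s) f x.1 * << x.2 >>) * << b >>); last first.
  by rewrite f_left /eps (negbTE s0) mulr0 mul0r.
rewrite mulr_sumr mulr_suml big_seq [RHS]big_seq; apply: eq_bigr => x hx.
have /andP[h1 h2] := splits_irr hs hx.
rewrite malgUM [LHS](conv_basis psym_bilin S idfun) [S _]lextU anti_dtens (anti_irr h1).
by rewrite /= -!mulrA malgUM.
Qed.

Lemma anti_right p :
  conv (ParSym K) idfun S (psym_comul K p) = (p == dempty)%:R *: << dempty >>.
Proof.
elim/diagram_ind_irr_r: p => [|p s s0 hs _].
  rewrite psym_comul0 (conv_basis psym_bilin) eqxx scale1r.
  by rewrite [S _]lextU anti0 [LHS]mul1r.
rewrite psym_comul_dtens; move: (psym_comul K p) => Y.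
have -> : (dtens p s == dempty) = false by rewrite (negbTE (dop_neq0r false _ s0)).
rewrite scale0r {1}[Y]malg_basis mulr_suml linear_sum.
rewrite big1 // => -[a b] _.
rewrite -scalerAl linearZ /=; apply/eqP; rewrite scaler_eq0; apply/orP; right; apply/eqP.
rewrite psym_comul_irr1 // mulr_sumr linear_sum /=.
transitivity (<< a >> * (\sum_(x <- splits true s) << x.1 >> * f x.2) * anti b); last first.
  by rewrite f_right /eps (negbTE s0) mulr0 mul0r.
rewrite mulr_sumr mulr_suml big_seq [RHS]big_seq; apply: eq_bigr => x hx.
have /andP[h1 h2] := splits_irr hs hx.
rewrite malgUM [LHS](conv_basis psym_bilin idfun S) [S _]lextU anti_dtens (anti_irr h2).
by rewrite /= -(malgUM K a x.1) -!mulrA.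
Qed.

End Antimorphism.

Lemma psym_antipode : exists S, is_antipode (ParSym K) S.
Proof.
have [f [hl hr]] := dbul_antipode_exists.
exists (lext (anti f) : {linear A -> A}); split.
  by apply: (conv_ext (cm := psym_comul K)) => // p; apply: anti_left.
by apply: (conv_ext (cm := psym_comul K)) => // p; apply: anti_right.
Qed.

End ParSymAntipode.

(** * Duality of ParSym and ParQSym *)

Lemma big_tuple_cons (V : nmodType) (T : finType) k (P : pred (k.+1.-tuple T))
    (F : k.+1.-tuple T -> V) :
  \sum_(t : k.+1.-tuple T | P t) F t =
  \sum_(x : T) \sum_(t : k.-tuple T | P [tuple of x :: t]) F [tuple of x :: t].
Proof.
rewrite pair_big_dep /=.
rewrite (reindex (fun z : T * k.-tuple T => [tuple of z.1 :: z.2])) //=.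
exists (fun t => (thead t, [tuple of behead t])) => [[x t] _|t _] /=.
  by congr pair; apply: val_inj.
by rewrite -tuple_eta.
Qed.

Lemma forall_ord_recl k (P : pred 'I_k.+1) :
  [forall i, P i] = P ord0 && [forall i : 'I_k, P (lift ord0 i)].
Proof.
apply/forallP/andP => [h|[h0 /forallP h] i].
  by split; [exact: h|apply/forallP => i; exact: h].
by case: (unliftP ord0 i) => [j ->|->].
Qed.

(* Strips the first letter p off the word w; the empty diagram is stripped for
   free. *)
Definition peel (p : diagram) (w : seq diagram) : option (seq diagram) :=
  if p == dempty then Some w
  else if w is h :: w' then if h == p then Some w' else None else None.

Lemma inflates_cons n k (x : bdiagram n) (t : k.-tuple (bdiagram n)) w :
  inflates [tuple of x :: t] w =
  if peel (bval x) w is Some w' then inflates t w' else false.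
Proof.
rewrite /inflates /peel /=; case: (bval x == dempty) => //=.
by case: w => //= h w; rewrite eqseq_cons eq_sym; case: eqP.
Qed.

Lemma peel_irr p w w' : irrword w -> peel p w = Some w' ->
  tens_irr p && irrword w'.
Proof.
rewrite /peel; case: eqP => [-> hw [<-]|_]; first by rewrite tens_irr0.
by case: w => // h w /andP[/andP[h0 hh] hw]; case: eqP => // <- [<-]; rewrite hh.
Qed.

Lemma peel_all (P : pred diagram) p w w' : P dempty -> all P w ->
  peel p w = Some w' -> P p && all P w'.
Proof.
move=> P0; rewrite /peel; case: eqP => [-> hw [<-]|_]; first by rewrite P0.
by case: w => // h w /andP[hh hw]; case: eqP => // <- [<-]; rewrite hh.
Qed.

Lemma peel_tword p w w' : peel p w = Some w' -> tword w = dtens p (tword w').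
Proof.
rewrite /peel; case: eqP => [-> [<-]|_]; first by rewrite dtens1p.
by case: w => // h w; case: eqP => // <- [<-]; rewrite tword_cons.
Qed.

Lemma peel_None p w q : irrword w -> tens_irr p -> peel p w = None ->
  dtens p q <> tword w.
Proof.
rewrite /peel => hw hp; case: eqP => // /eqP p0; case: w hw => [_ _|h w].
  by rewrite /tword big_nil => /dtens_eq1[e _]; rewrite e eqxx in p0.
case/andP => /andP[h0 hh] hw; rewrite tword_cons; case: eqP => // nhp _ e.
by have [/esym] := irr_dtens_inj p0 hp h0 hh e.
Qed.

Lemma dtens_irr_injr p q q' : tens_irr p -> dtens p q = dtens p q' -> q = q'.
Proof.
move=> hp; have [->|p0] := eqVneq p dempty; first by rewrite !dtens1p.
by case/(irr_dtens_inj p0 hp p0 hp).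
Qed.

Section Duality.
Variable K : fieldType.
Local Notation A := {malg K[diagram]}.

(** A summand of [pqsym_mul_basis] with the words decoupled from the order bounds: in the induction
    on k the words get shorter while the bounds stay. *)
Definition columns (n m k : nat) (a b : seq diagram) : A :=
  \sum_(t : k.-tuple (bdiagram n) | inflates t a)
    \sum_(u : k.-tuple (bdiagram m) | inflates u b &&
          [forall i, dbul (bval (tnth t i)) (bval (tnth u i)) != dempty])
      << \big[dtens/dempty]_(i < k) dbul (bval (tnth t i)) (bval (tnth u i)) >>.

Lemma columns0 n m a b :
  columns n m 0 a b = if (a == [::]) && (b == [::]) then << dempty >> else 0.
Proof.
have inf0 l (t : 0.-tuple (bdiagram l)) w : inflates t w = (w == [::]).
  by rewrite /inflates (tuple0 t) eq_sym.
rewrite /columns.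
transitivity (\sum_(t : 0.-tuple (bdiagram n) | a == [::])
   \sum_(u : 0.-tuple (bdiagram m) | b == [::]) (<< dempty >> : A)).
  apply: eq_big => [t|t _]; first exact: inf0.
  apply: eq_big => [u|u _]; last by rewrite big_ord0.
  by rewrite inf0; case: (b == _) => //=; apply/forallP => -[].
have E l (c : bool) (v : A) :
    \sum_(t : 0.-tuple (bdiagram l) | c) v = if c then v else 0.
  case: c; last by rewrite big_pred0.
  by rewrite (big_pred1 [tuple]) // => t; rewrite (tuple0 t) /= eqxx.
by rewrite !E; case: (a == _).
Qed.

Lemma columnsS n m k a b : columns n m k.+1 a b =
  \sum_(x <- [seq (p, q) | p <- dlist n, q <- dlist m])
    if dbul x.1 x.2 == dempty then 0
    else if peel x.1 a is Some a' then
      if peel x.2 b is Some b' then << dbul x.1 x.2 >> * columns n m k a' b' else 0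
    else 0.
Proof.
rewrite -(big_bdiagram2 n m (fun p q => if dbul p q == dempty then 0
    else if peel p a is Some a' then
      if peel q b is Some b' then << dbul p q >> * columns n m k a' b' else 0
    else 0)).
rewrite /columns big_tuple_cons; apply: eq_bigr => x _.
transitivity (\sum_(t : k.-tuple (bdiagram n) |
    if peel (bval x) a is Some a' then inflates t a' else false)
  \sum_(y : bdiagram m) \sum_(u : k.-tuple (bdiagram m) |
     [&& if peel (bval y) b is Some b' then inflates u b' else false,
         dbul (bval x) (bval y) != dempty &
         [forall i, dbul (bval (tnth t i)) (bval (tnth u i)) != dempty]])
     (<< dtens (dbul (bval x) (bval y))
       (\big[dtens/dempty]_(i < k) dbul (bval (tnth t i)) (bval (tnth u i))) >> : A)).
  apply: eq_big => [t|t _]; first exact: inflates_cons.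
  rewrite big_tuple_cons; apply: eq_bigr => y _; apply: eq_big => [u|u _].
    rewrite forall_ord_recl !tnth0; congr [&& _, _ & _]; first exact: inflates_cons.
    by apply: eq_forallb => i; rewrite !tnthS.
  rewrite big_ord_recl !tnth0; congr << dtens _ _ >>.
  by apply: eq_bigr => i _; rewrite !tnthS.
rewrite exchange_big /=; apply: eq_bigr => y _.
have [e|e] := boolP (dbul (bval x) (bval y) == dempty).
  rewrite big1 // => t _; rewrite big_pred0 // => u.
  by rewrite andbF.
case: (peel (bval x) a) => [a'|]; last by rewrite big_pred0.
case: (peel (bval y) b) => [b'|]; last first.
  by rewrite big1 // => t _; rewrite big_pred0.
rewrite mulr_sumr; apply: eq_bigr => t _; rewrite mulr_sumr.
apply: eq_bigr => u _; exact: esym (malgUM _ _ _).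
Qed.

(** Each column is a non-empty \bullet-product of irreducibles, hence itself irreducible. Reaching
    the word w therefore takes exactly [size w] columns, each a \bullet-splitting of the
    corresponding letter, and this is how the coproduct of ParSym is built. *)
Lemma columnsE n m k a b w :
  irrword a -> irrword b -> irrword w ->
  all (fun p => order p <= n)%N a -> all (fun p => order p <= m)%N b ->
  (columns n m k a b)@_(tword w) =
  if size w == k then (psym_comul K (tword w))@_(tword a, tword b) else 0.
Proof.
elim: k a b w => [|k IH] a b w ha hb hw an bm.
  rewrite columns0; case: w hw => [_|s w hw].
    rewrite [tword [::]]big_nil eqxx psym_comul0 mcoeffU xpair_eqE.
    have E v : irrword v -> (dempty == tword v) = (v == [::]).
      case: v => [_|h v]; first by rewrite [tword _]big_nil !eqxx.
      case/andP => /andP[h0 _] _; rewrite tword_cons eq_sym.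
      by rewrite (negbTE (dop_neq0 false _ h0)).
    rewrite !E //; case: ifP => _; last by rewrite mcoeff0.
    by rewrite mcoeffUU.
  case: ifP => _; last by rewrite mcoeff0.
  case/andP: hw => /andP[s0 _] _; rewrite tword_cons mcoeffU eq_sym.
  by rewrite (negbTE (dop_neq0 false _ s0)).
rewrite columnsS raddf_sum /=.
case: w hw => [_|s w /andP[/andP[s0 hs] hw]].
  rewrite [tword [::]]big_nil big1 // => x _.
  case: eqP => [_|e]; first by rewrite mcoeff0.
  case: (peel _ a) => [a'|]; last by rewrite mcoeff0.
  case: (peel _ b) => [b'|]; last by rewrite mcoeff0.
  by apply: mcoeffUM_out => y _ /dtens_eq1[/e].
rewrite tword_cons.
pose F (x : diagram * diagram) : K :=
  if dbul x.1 x.2 == s then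
    if peel x.1 a is Some a' then
      if peel x.2 b is Some b' then
        if size w == k then (psym_comul K (tword w))@_(tword a', tword b') else 0
      else 0
    else 0
  else 0.
transitivity (\sum_(x <- [seq (p, q) | p <- dlist n, q <- dlist m]) F x).
  apply: eq_bigr => x _; rewrite /F.
  case: eqP => [e|e].
    by rewrite mcoeff0; case: eqP => // e'; rewrite -e' e eqxx in s0.
  case ea: (peel _ a) => [a'|]; last by rewrite mcoeff0 if_same.
  case eb: (peel _ b) => [b'|]; last by rewrite mcoeff0 if_same.
  have /andP[i1 ha'] := peel_irr ha ea; have /andP[i2 hb'] := peel_irr hb eb.
  have /andP[_ an'] := peel_all (isT : order dempty <= n)%N an ea.
  have /andP[_ bm'] := peel_all (isT : order dempty <= m)%N bm eb.
  have d0 : dbul x.1 x.2 != dempty by apply/eqP.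
  have di := tens_irr_dbul i1 i2.
  case: (eqVneq (dbul x.1 x.2) s) => [es|nes].
    rewrite -IH //; apply: mcoeffUM_in; last by rewrite es.
    move=> y e'; apply: (dtens_irr_injr di).
    by rewrite [RHS](congr1 (dtens^~ _) es).
  apply: mcoeffUM_out => y _ e'.
  by have [e1 _] := irr_dtens_inj d0 di s0 hs e'; rewrite e1 eqxx in nes.
(* The letters of a and b obey the bounds n and m, so every splitting that survives [peel] is among
   the pairs. *)
transitivity (\sum_(x <- splits true s) F x).
  apply: big_uniq_supp; rewrite ?pairs_uniq ?splits_uniq // => x.
    by rewrite mem_splits /F => _ /negbTE; rewrite /dop => ->.
  rewrite mem_pairs /F => _; case: ifP => // _.
  case ea: (peel _ a) => [a'|//]; case eb: (peel _ b) => [b'|//].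
  have /andP[-> _] := peel_all (isT : order dempty <= n)%N an ea.
  by have /andP[-> _] := peel_all (isT : order dempty <= m)%N bm eb.
have -> : (size (s :: w) == k.+1) = (size w == k) by [].
rewrite psym_comul_dtens psym_comul_irr1 // mulr_suml raddf_sum /=.
transitivity (\sum_(x <- splits true s) if size w == k then
   (<< x >> * psym_comul K (tword w))@_(tword a, tword b) else 0); last first.
  by case: ifP => // _; rewrite big1.
rewrite big_seq [RHS]big_seq; apply: eq_bigr => x hx.
have /andP[i1 i2] := splits_irr hs hx.
have e : dbul x.1 x.2 = s by move: hx; rewrite mem_splits => /eqP.
rewrite /F e eqxx; case: (size w == k); last by do 2 case: (peel _ _).
case ea: (peel _ a) => [a'|]; last first.
  apply/esym/mcoeffUM_out => y _ e'.
  exact: (peel_None (q := y.1) ha i1 ea (congr1 fst e')).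
case eb: (peel _ b) => [b'|]; last first.
  apply/esym/mcoeffUM_out => y _ e'.
  exact: (peel_None (q := y.2) hb i2 eb (congr1 snd e')).
rewrite (peel_tword ea) (peel_tword eb); apply/esym/mcoeffUM_in => // y e'.
rewrite [y]surjective_pairing.
by rewrite (dtens_irr_injr i1 (congr1 fst e')) (dtens_irr_injr i2 (congr1 snd e')).
Qed.

Lemma tfactors_order p : all (fun q => order q <= order p)%N (tfactors p).
Proof.
rewrite -{1}(tword_tfactors p); elim: (tfactors p) => //= s w IH.
rewrite tword_cons order_dtens leq_addr; apply: sub_all IH => q /leq_trans; apply.
exact: leq_addl.
Qed.

(* ParQSym is the graded dual of ParSym: this is the product side of it. *)
Lemma pqsym_mul_dual r s t :
  (pqsym_mul_basis K r s)@_t = (psym_comul K t)@_(r, s).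
Proof.
have -> : pqsym_mul_basis K r s = \sum_(k < (dlength r + dlength s).+1)
    columns (order r) (order s) k (tfactors r) (tfactors s) by [].
rewrite raddf_sum.
have E n m k a b w p q z : irrword a /\ tword a = p -> irrword b /\ tword b = q ->
    irrword w /\ tword w = z ->
    all (fun d => order d <= n)%N a -> all (fun d => order d <= m)%N b ->
    (columns n m k a b)@_z = if size w == k then (psym_comul K z)@_(p, q) else 0.
  by move=> [ha <-] [hb <-] [hw <-]; apply: columnsE.
transitivity (\sum_(k < (dlength r + dlength s).+1)
   if dlength t == k then (psym_comul K t)@_(r, s) else 0).
  apply: eq_bigr => k _; exact: (E _ _ k _ _ _ _ _ _ (tfactorsP r) (tfactorsP s) (tfactorsP t)
    (tfactors_order r) (tfactors_order s)).
case: (boolP ((r, s) \in msupp (psym_comul K t))) => h; last first.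
  by rewrite (mcoeff_outdom h) big1 // => k _; rewrite if_same.
(* Only k = [dlength t] contributes, and it lies in the range of summation. *)
have lt : (dlength t < (dlength r + dlength s).+1)%N.
  by rewrite ltnS; exact: psym_comul_dlength h.
rewrite -big_mkcond (big_pred1 (Ordinal lt)) // => k.
Qed.

End Duality.

(** * The antipode of ParQSym *)

Section ParQSymHopf.
Variable K : fieldType.
Local Notation A := {malg K[diagram]}.
Local Notation A2 := {malg K[(diagram * diagram)%type]}.

Lemma pqsym_comul_basisE s :
  pqsym_comul_basis K s = \sum_(x <- splits false s) << x >>.
Proof.
under eq_bigr do rewrite [x in << x >>]surjective_pairing.
by rewrite -(big_splits false s (fun p q => << (p, q) >>)).
Qed.

Lemma mcoeff_splits b s x :
  (\sum_(y <- splits b s) << y >> : A2)@_x = (dop b x.1 x.2 == s)%:R.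
Proof.
rewrite raddf_sum /= -mem_splits; case: (boolP (x \in splits b s)) => hx.
  rewrite (big_uniq_only (splits_uniq b s) hx); first exact: mcoeffUU.
  by move=> y _ /negbTE nyx; rewrite mcoeffU nyx.
rewrite big_seq big1 // => y hy; rewrite mcoeffU.
by case: eqVneq hx => // <-; rewrite hy.
Qed.

Lemma mcoeff_pqsym_comul s x :
  (pqsym_comul_basis K s)@_x = (dtens x.1 x.2 == s)%:R.
Proof. by rewrite pqsym_comul_basisE mcoeff_splits. Qed.

Lemma msupp_pqsym_comul s x :
  (x \in msupp (pqsym_comul_basis K s)) = (dtens x.1 x.2 == s).
Proof.
by rewrite -mcoeff_neq0 mcoeff_pqsym_comul; case: (_ == s); rewrite ?oner_eq0 ?eqxx.
Qed.

Lemma pqsym_mulUU p q : hmul (ParQSym K) << p >> << q >> = pqsym_mul_basis K p q.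
Proof. by rewrite [LHS]lextU lextU. Qed.

Lemma pqsym_bilin (u v : A) : hmul (ParQSym K) u v =
  lext (fun b => lext (fun c => hmul (ParQSym K) << b >> << c >>) v) u.
Proof.
apply: eq_bigr => b _; congr (_ *: _); apply: eq_bigr => c _.
by rewrite pqsym_mulUU.
Qed.

Lemma mcoeff_pqsym_mul (u v : A) t : (hmul (ParQSym K) u v)@_t =
  \sum_(x <- msupp (psym_comul K t)) u@_x.1 * v@_x.2 * (psym_comul K t)@_x.
Proof.
transitivity (\sum_(x <- [seq (a, b) | a <- msupp u, b <- msupp v])
    u@_x.1 * v@_x.2 * (psym_comul K t)@_x).
  rewrite big_allpairs [in LHS]/= /lext raddf_sum; apply: eq_bigr => a _.
  rewrite [LHS]mcoeffZ raddf_sum mulr_sumr; apply: eq_bigr => b _.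
  by rewrite [X in _ * X]mcoeffZ pqsym_mul_dual mulrA.
apply: big_uniq_supp; rewrite ?fset_uniq //.
- by apply: allpairs_uniq; rewrite ?fset_uniq // => -[? ?] [? ?] _ _ [-> ->].
- by move=> x _ /mcoeff_outdom ->; rewrite mulr0.
move=> [a b] _ /=; case: (boolP (a \in msupp u)) => [ha|/mcoeff_outdom ->].
  case: (boolP (b \in msupp v)) => [hb|/mcoeff_outdom ->]; last by rewrite mulr0 mul0r.
  by case/negP; apply/allpairsP; exists (a, b).
by rewrite !mul0r.
Qed.

Lemma mcoeff_psym_mul (u v : A) t :
  (u * v)@_t = \sum_(x <- splits false t) u@_x.1 * v@_x.2.
Proof.
pose F (x : diagram * diagram) := (u@_x.1 * v@_x.2) *+ (dtens x.1 x.2 == t).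
transitivity (\sum_(x <- [seq (a, b) | a <- msupp u, b <- msupp v]) F x).
  by rewrite big_allpairs mcoeffMl.
transitivity (\sum_(x <- splits false t) F x); last first.
  rewrite big_seq [RHS]big_seq; apply: eq_bigr => x.
  by rewrite mem_splits /F => ->.
apply: big_uniq_supp; rewrite ?splits_uniq //.
- by apply: allpairs_uniq; rewrite ?fset_uniq // => -[? ?] [? ?] _ _ [-> ->].
- by move=> x _; rewrite mem_splits /F => /negbTE ->.
move=> [a b] _ /=; rewrite /F /=; case: (boolP (a \in msupp u)) => [ha|/mcoeff_outdom ->].
  case: (boolP (b \in msupp v)) => [hb|/mcoeff_outdom ->]; last by rewrite mulr0 mul0rn.
  by case/negP; apply/allpairsP; exists (a, b).
by rewrite mul0r mul0rn.
Qed.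

(** The transpose of [psym_comul_counit]. *)
Lemma pqsym_mul1 (u : A) : hmul (ParQSym K) u << dempty >> = u.
Proof.
apply/malgP => t; rewrite mcoeff_pqsym_mul.
rewrite (@big_uniq_only _ _ _ _ (t, dempty)) ?fset_uniq //.
- by rewrite mcoeffUU psym_comul_counit eqxx !mulr1.
- by rewrite -mcoeff_neq0 psym_comul_counit eqxx oner_eq0.
move=> [a b] _ nx; rewrite mcoeffU [(_, _).2]/=.
case: eqP => [eb|_]; last by rewrite mulr0 mul0r.
rewrite -eb psym_comul_counit; case: eqP => [ea|_]; last by rewrite mulr0.
by rewrite -eb ea eqxx in nx.
Qed.

Lemma pqsym_counit p a : (pqsym_comul_basis K p)@_(a, dempty) = (a == p)%:R.
Proof. by rewrite mcoeff_pqsym_comul [(_, _).1]/= [(_, _).2]/= dtensp1. Qed.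

Lemma pqsym_comul_order p x : x \in msupp (pqsym_comul_basis K p) ->
  (order x.1 + order x.2)%N = order p.
Proof. by rewrite msupp_pqsym_comul => /eqP <-; rewrite order_dtens. Qed.

(** Both coefficients are the same double sum, over the tensor splittings of p and the terms of the
    ParSym coproduct of q. *)
Lemma conv_dual (f g f' g' : {linear A -> A}) p q :
  (forall a b, (f' << a >>)@_b = (f << b >>)@_a) ->
  (forall a b, (g' << a >>)@_b = (g << b >>)@_a) ->
  (conv (ParQSym K) f' g' (pqsym_comul_basis K p))@_q =
  (conv (ParSym K) f g (psym_comul K q))@_p.
Proof.
move=> hf hg; rewrite pqsym_comul_basisE [conv (ParQSym K) _ _ _]linear_sum [LHS]raddf_sum.
rewrite [conv (ParSym K) _ _ _](convE (@psym_bilin K)) [RHS]raddf_sum.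
transitivity (\sum_(y <- splits false p) \sum_(x <- msupp (psym_comul K q))
    (psym_comul K q)@_x * ((f << x.1 >>)@_y.1 * (g << x.2 >>)@_y.2)).
  apply: eq_bigr => y _.
  transitivity ((hmul (ParQSym K) (f' << y.1 >>) (g' << y.2 >>))@_q).
    by congr (_@_q); exact: (conv_basis pqsym_bilin f' g').
  rewrite [LHS]mcoeff_pqsym_mul; apply: eq_bigr => x _.
  by rewrite hf hg mulrC.
rewrite exchange_big; apply: eq_bigr => x _.
by rewrite [RHS]mcoeffZ mcoeff_psym_mul mulr_sumr.
Qed.

(** Homogeneity leaves only finitely many p with t in the support of S(p), so the transpose of S is
    again an endomorphism of the free module. *)
Lemma psym_antipode_order (S : {linear A -> A}) p q :
  is_antipode (ParSym K) S -> (S << p >>)@_q != 0 -> order q = order p.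
Proof.
move=> [hS _] hq.
have h : suppin (Aset (order p)) (S << p >>).
  apply: (@antipode_supp K (ParSym K) (psym_comul K) (@psym_bilin K) (@psym_comulE K)
    erefl (fun=> erefl) (@psym_mul1 K) (@psym_comul_counit K) (@psym_comul_order K)
    S Aset hS) => //.
    by move=> n r x; apply: (psym_comul_degree Aset_additive).
  move=> n m a b ha hb; rewrite [hmul _ _ _]malgUM; apply: suppinU.
  exact: (degree_dop Aset_additive false ha hb).
by apply: h; rewrite -mcoeff_neq0.
Qed.

Lemma pqsym_antipode : exists S, is_antipode (ParQSym K) S.
Proof.
have [S hS] := psym_antipode K.
pose T (t : diagram) : A := \sum_(p <- dlist (order t)) (S << p >>)@_t *: << p >>.
have hT a b : (lext T << a >>)@_b = (S << b >>)@_a.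
  rewrite lextU raddf_sum.
  transitivity (\sum_(p <- dlist (order a)) if p == b then (S << b >>)@_a else 0).
    apply: eq_bigr => p _; rewrite [LHS]mcoeffZ mcoeffU.
    by case: eqP => [->|_]; rewrite ?mulr1 ?mulr0.
  case: (boolP (b \in dlist (order a))) => hb.
    by rewrite (@big_uniq_only _ _ _ _ b) ?dlist_uniq ?eqxx // => p _ /negbTE ->.
  rewrite big_seq big1 => [|p hp].
    apply/esym/eqP; apply: contraR hb => /(psym_antipode_order hS) ->.
    by rewrite mem_dlist.
  by case: eqP hp hb => // -> ->.
have hid a b : ((idfun : {linear A -> A}) << a >>)@_b =
    ((idfun : {linear A -> A}) << b >>)@_a.
  by rewrite /= !mcoeffU eq_sym.
case: hS => [hl hr].
have key (f g f' g' : {linear A -> A}) :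
    (forall a b, (f' << a >>)@_b = (f << b >>)@_a) ->
    (forall a b, (g' << a >>)@_b = (g << b >>)@_a) ->
    (forall x, hmul_tens (ParSym K) (tensmap f g (hcomul (ParSym K) x)) =
       hcounit (ParSym K) x *: hone (ParSym K)) ->
    forall x, hmul_tens (ParQSym K) (tensmap f' g' (hcomul (ParQSym K) x)) =
       hcounit (ParQSym K) x *: hone (ParQSym K).
  move=> hf hg h; apply: (@conv_ext K (ParQSym K) (pqsym_comul_basis K)
    (fun=> erefl) erefl (fun=> erefl)) => p.
  apply/malgP => q; rewrite (conv_dual p q hf hg).
  have := h << q >>; rewrite psym_comulE lextU -/(conv _ _ _ _) => ->.
  (* The matrix of the counit followed by the unit is symmetric. *)
  rewrite !mcoeffZ !mcoeffU ![dempty == _]eq_sym.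
  by rewrite [hcounit _ _]mcoeffU mulrC.
exists (lext T : {linear A -> A}); split.
  exact: (key S idfun (lext T) idfun hT hid hl).
exact: (key idfun S idfun (lext T) hid hT hr).
Qed.

End ParQSymHopf.

(** * The filtrations *)

Lemma exists_argmax (T : eqType) (f : T -> nat) (s : seq T) p0 : p0 \in s ->
  exists2 p, p \in s & forall q, q \in s -> (f q <= f p)%N.
Proof.
elim: s p0 => // p s IH p0 _; case: s IH => [_|q s IH].
  exists p; first exact: mem_head.
  move=> q; rewrite inE => /eqP ->; exact: leqnn.
have [r rs hr] := IH q (mem_head q s).
have [le|lt] := leqP (f r) (f p).
  exists p; first exact: mem_head.
  move=> q'; rewrite inE => /orP[/eqP ->|/hr h]; [exact: leqnn|exact: leq_trans h le].
exists r; first by rewrite inE rs orbT.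
move=> q'; rewrite inE => /orP[/eqP ->|/hr h]; [exact: ltnW lt|exact: h].
Qed.

Section Filtrations.
Variable K : fieldType.
Local Notation A := {malg K[diagram]}.
Local Notation A2 := {malg K[(diagram * diagram)%type]}.

Lemma psym_mul_degree X (hX : forall n m p q, X n p -> X m q -> X (n + m)%N (dtens p q))
    n m p q : X n p -> X m q ->
  suppin (fun r => exists2 i, (i <= n + m)%N & X i r) (hmul (ParSym K) << p >> << q >>).
Proof.
move=> hp hq; rewrite [hmul _ _ _]malgUM; apply: suppinU.
by exists (n + m)%N => //; exact: hX.
Qed.

Lemma psym_hopf_filtration X : additive_degree X -> hopf_filtration (ParSym K) (filt K X).
Proof.
move=> hX; apply: (@filt_hopf K (ParSym K) (psym_comul K) (@psym_bilin K) (@psym_comulE K)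
    erefl (fun=> erefl) (@psym_mul1 K) (@psym_comul_counit K) (@psym_comul_order K) X).
- exact: degree_total hX.
- by apply: psym_mul_degree; exact: degree_dop hX false.
- by move=> n p x; apply: (psym_comul_degree hX).
- exact: psym_antipode.
Qed.

(** The second premise is the condition on the product, read through duality on the coproduct of
    ParSym. It is an inequality because [filt] is cumulative, which admits [Pset]. *)
Lemma pqsym_hopf_filtration X :
  (forall p, exists n, X n p) ->
  (forall n m p x, X n x.1 -> X m x.2 -> x \in msupp (psym_comul K p) ->
     exists2 i, (i <= n + m)%N & X i p) ->
  (forall n p q, X n (dtens p q) -> exists i j, [/\ (i + j)%N = n, X i p & X j q]) ->
  hopf_filtration (ParQSym K) (filt K X).
Proof.
move=> h1 h2 h3; apply: (@filt_hopf K (ParQSym K) (pqsym_comul_basis K) (@pqsym_bilin K)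
    (fun=> erefl) erefl (fun=> erefl) (@pqsym_mul1 K) (@pqsym_counit K)
    (@pqsym_comul_order K) X h1).
- move=> n m p q hp hq r; rewrite pqsym_mulUU -mcoeff_neq0 pqsym_mul_dual mcoeff_neq0.
  exact: (h2 n m r (p, q)).
- move=> n p x hp; rewrite msupp_pqsym_comul => /eqP e; apply: h3.
  by rewrite e.
- exact: pqsym_antipode.
Qed.

Lemma pqsym_additive_filtration X :
  additive_degree X -> hopf_filtration (ParQSym K) (filt K X).
Proof.
move=> hX; apply: pqsym_hopf_filtration.
- exact: degree_total hX.
- move=> n m p x h1 h2 hx; exists (n + m)%N => //.
  have [k hk] := degree_total hX p.
  have [i [j [e hi hj]]] := psym_comul_degree hX hk hx.
  by rewrite (degree_inj hX h1 hi) (degree_inj hX h2 hj) e.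
- by move=> n p q; apply: (@degree_split X false n p q hX).
Qed.

Lemma pqsym_Pset_filtration : hopf_filtration (ParQSym K) (filt K Pset).
Proof.
apply: pqsym_hopf_filtration.
- by move=> p; exists (dlength p).
- by move=> n m p x <- <- /psym_comul_dlength le; exists (dlength p).
- by move=> n p q <-; exists (dlength p), (dlength q); rewrite dlength_dtens.
Qed.

Lemma psym_Pset_algebra : algebra_filtration (ParSym K) (filt K Pset).
Proof.
apply: (@filt_algebra K (ParSym K) (@psym_bilin K) Pset) => [p|].
  by exists (dlength p).
by apply: psym_mul_degree => n m p q <- <-; exact: dlength_dtens.
Qed.

Lemma filt_PsetE n x :
  filt K Pset n x <-> suppin (fun p => (dlength p <= n)%N) x.
Proof.
split; first by move/filtE; apply: suppinW => p [i + e]; rewrite (e : dlength p = i).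
by move=> h; apply/filtE; apply: suppinW h => p hp; exists (dlength p).
Qed.

Lemma order1_irr p : order p = 1 -> tens_irr p.
Proof.
move=> p1; apply/tens_irrP => q r e.
have : (order q + order r)%N = 1 by rewrite -p1 -e order_dtens.
case eq: (order q) => [|[|k]] // h; first by left; apply/eqP; rewrite -order_eq0 eq.
by right; apply/eqP; rewrite -order_eq0; case: h => /eqP; rewrite eqn0Ngt; case: order.
Qed.

(* A product u \bullet u of two length-one diagrams has length one, but its
   coproduct contains u (x) u. *)
Lemma psym_Pset_not_coalgebra : ~ coalgebra_filtration (ParSym K) (filt K Pset).
Proof.
(* Since the empty diagram relates no labels, u is the diagram of order one with two singleton
   blocks. *)
pose u : diagram := dtake 1 dempty.
have u1 : order u = 1 by [].
have hu := order1_irr u1.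
have u0 : u != dempty by rewrite -order_eq0 u1.
have lu : dlength u = 1 := dlength_irr u0 hu.
pose s := dbul u u.
have hs : tens_irr s := tens_irr_dbul hu hu.
have s0 : s != dempty := dop_neq0 true u u0.
have hx : filt K Pset 1 << s >>.
  by apply/filt_PsetE; apply: suppinU; rewrite (dlength_irr s0 hs).
case=> _ /(_ 1 _ hx) [x [hW]]; rewrite psym_comulE lextU psym_comul_irr1 // => e.
have hin : (u, u) \in msupp (\sum_(x <- splits true s) << x >> : A2).
  by rewrite -mcoeff_neq0 mcoeff_splits eqxx oner_eq0.
(* In filtration degree one, one of the two tensor legs has degree zero. *)
have : suppin (fun y => (dlength y.1 <= 0)%N \/ (dlength y.2 <= 0)%N) (\sum_i x i).
  apply: (subspace_sum (suppin_subspace _ _)) => i _ _ y hy.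
  have : tenssp (suppin (fun p => dlength p <= i)%N)
      (suppin (fun p => dlength p <= 1 - i)%N) (x i).
    by apply: tenssp_incl (hW i) => v /filt_PsetE.
  move/tenssp_suppin => /(_ y hy)[]; case: i {hy} => -[|[|i]] //= _ h1 h2.
    by left.
  by right.
by rewrite -e => /(_ _ hin) /=; rewrite lu => -[].
Qed.

(** * The coradical filtration of ParQSym *)

Lemma mcoeff_pqsym_hcomul x y : (hcomul (ParQSym K) x)@_y = x@_(dtens y.1 y.2).
Proof.
have -> : hcomul (ParQSym K) x = \sum_(p <- msupp x) x@_p *: pqsym_comul_basis K p by [].
rewrite raddf_sum.
transitivity (\sum_(p <- msupp x) if p == dtens y.1 y.2 then x@_(dtens y.1 y.2) else 0).
  apply: eq_bigr => p _; rewrite [LHS]mcoeffZ mcoeff_pqsym_comul eq_sym.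
  by case: eqP => [->|_]; rewrite ?mulr1 ?mulr0.
case: (boolP (dtens y.1 y.2 \in msupp x)) => hy.
  rewrite (big_uniq_only (fset_uniq _) hy) ?eqxx // => p _ /negbTE -> //.
rewrite (mcoeff_outdom hy) big1 // => p _; case: eqP => //.
Qed.

(** The identity tensored with the coordinate functional of p. *)
Definition contract (p : diagram) : A2 -> A :=
  lext (fun x => if x.2 == p then << x.1 >> else 0).

Lemma mcoeff_contract p t a : (contract p t)@_a = t@_(a, p).
Proof.
rewrite /contract /lext raddf_sum.
transitivity (\sum_(x <- msupp t) if x == (a, p) then t@_(a, p) else 0).
  apply: eq_bigr => -[b q] _; rewrite [LHS]mcoeffZ [(_, _).1]/= [(_, _).2]/= xpair_eqE.
  case: (eqVneq q p) => [->|_]; last by rewrite andbF mcoeff0 mulr0.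
  by rewrite mcoeffU andbT; case: eqP => [->|_]; rewrite ?mulr1 ?mulr0.
case: (boolP ((a, p) \in msupp t)) => hy.
  by rewrite (big_uniq_only (fset_uniq _) hy) ?eqxx // => x _ /negbTE ->.
by rewrite (mcoeff_outdom hy) big1 // => x _; case: eqP.
Qed.

Lemma contract_tenssp (D : A -> Prop) p t : subspace D ->
  tenssp D (fun=> True) t -> D (contract p t).
Proof.
move=> hD; move: t; apply: (@subspace_span _ _ (fun t => D (contract p t))).
  split; first by rewrite /contract linear0; case: hD.
  by move=> c x y hx hy; rewrite /contract linearP; case: hD => _; apply.
move=> _ [u [v [hu _ ->]]].
have -> : contract p (tens u v) = v@_p *: u.
  by apply/malgP => a; rewrite mcoeff_contract tensE mcoeffZ mulrC.
exact: subspaceZ.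
Qed.

(* Contracting the coproduct of x against a longest diagram p of its support
   leaves only the term of the empty diagram. *)
Lemma subcoalgebra_unit (D : A -> Prop) x :
  subcoalgebra (ParQSym K) D -> D x -> x <> 0 -> D << dempty >>.
Proof.
move=> [hD hc] hx x0.
have [p0 hp0] : exists p, p \in msupp x.
  have [e|[p hp]] := fset_0Vmem (msupp x); last by exists p.
  by case: x0; rewrite [x]malg_basis e big_seq_fset0.
have [p hp pmax] := exists_argmax dlength hp0.
have hDp : D (contract p (hcomul (ParQSym K) x)).
  by apply: contract_tenssp => //; apply: tenssp_incl (hc x hx).
have e : contract p (hcomul (ParQSym K) x) = x@_p *: << dempty >>.
  apply/malgP => a; rewrite mcoeff_contract mcoeff_pqsym_hcomul mcoeffZ mcoeffU.
  rewrite [(_, _).1]/= [(_, _).2]/=.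
  case: (eqVneq dempty a) => [<-|a0]; first by rewrite dtens1p mulr1.
  (* For non-empty a, the diagram [dtens a p] is longer than p, so it is outside the support of
     x. *)
  rewrite mulr0; apply: mcoeff_outdom; apply/negP => /pmax.
  rewrite dlength_dtens leqNgt -[X in (X < _)%N]add0n ltn_add2r lt0n dlength_eq0.
  by rewrite eq_sym a0.
have xp : x@_p != 0 by rewrite mcoeff_neq0.
have -> : << dempty >> = (x@_p)^-1 *: (x@_p *: << dempty >>) :> A.
  by rewrite scalerA mulVf // scale1r.
by rewrite -e; apply: subspaceZ.
Qed.

Let line : A -> Prop := suppin (fun p => p = dempty).

Lemma line_incl (D : A -> Prop) : subspace D -> D << dempty >> -> incl line D.
Proof. by move=> hD h1; apply: (subspace_suppin hD) => p ->; exact: h1. Qed.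

Lemma line_subcoalgebra : subcoalgebra (ParQSym K) line.
Proof.
split=> [|x hx]; first exact: suppin_subspace.
apply/tenssp_suppin => y; rewrite -mcoeff_neq0 mcoeff_pqsym_hcomul mcoeff_neq0.
by move/hx/dtens_eq1.
Qed.

Lemma unit_neq0 : << dempty >> <> 0 :> A.
Proof. by move/eqP; rewrite monalgU_eq0 oner_eq0. Qed.

(** Every non-zero subcoalgebra contains [line], so [line] is simple and the only simple
    subcoalgebra. *)
Lemma pqsym_coradicalE x : coradical (ParQSym K) x <-> line x.
Proof.
split.
  apply: subspace_span; first exact: suppin_subspace.
  move=> y [D [[hD [z [hz z0]] hmin] hy]].
  have h1 := subcoalgebra_unit hD hz z0.
  have [h|h] := hmin line line_subcoalgebra (line_incl hD.1 h1); last exact: h.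
  by case: unit_neq0; apply: h; apply: suppinU.
move=> hx; apply: span_gen; exists line; split => //; split.
- exact: line_subcoalgebra.
- by exists << dempty >>; split; [apply: suppinU|exact: unit_neq0].
(* E is an arbitrary predicate, so deciding whether it is zero takes excluded middle. *)
move=> E hE _; have [[z [hz z0]]|h] := classic (exists z, E z /\ z <> 0).
  by right; apply: line_incl; [case: hE|apply: subcoalgebra_unit hz z0].
by left=> z hz; apply: NNPP => z0; apply: h; exists z.
Qed.

Lemma pqsym_coradical_filtrationE n x :
  coradical_filtration (ParQSym K) n x <-> suppin (fun p => (dlength p <= n)%N) x.
Proof.
elim: n x => [|n IH] x.
  have E p : (dlength p <= 0)%N <-> p = dempty.
    by rewrite leqn0 dlength_eq0; split=> [/eqP|->].
  split; first by move/pqsym_coradicalE; apply: suppinW => p /E.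
  by move=> h; apply/pqsym_coradicalE; apply: suppinW h => p /E.
(* Both summands in the definition are spanned by basis pairs, so their sum is again a support
   condition. *)
have step : coradical_filtration (ParQSym K) n.+1 x <->
    suppin (fun y => (dlength y.2 <= n)%N \/ y.1 = dempty) (hcomul (ParQSym K) x).
  split.
    case=> y [z [hy hz ->]]; apply: (subspaceD (suppin_subspace _ _)).
      have : tenssp (suppin (fun=> True)) (suppin (fun p => dlength p <= n)%N) y.
        by apply: tenssp_incl hy => // v /IH.
      by move/tenssp_suppin; apply: suppinW => w []; left.
    have : tenssp line (suppin (fun=> True)) z.
      by apply: tenssp_incl hz => // v /pqsym_coradicalE.
    by move/tenssp_suppin; apply: suppinW => w []; right.
  apply: (subspace_suppin (addsp_subspace (tenssp_subspace _ _) (tenssp_subspace _ _))).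
  move=> [a b] h.
  have t0 (U W : A -> Prop) : tenssp U W 0 by case: (tenssp_subspace U W).
  case: h => [hb|ha].
    exists << (a, b) >>, 0; split; [|exact: t0|by rewrite addr0].
    apply: span_gen; exists << a >>, << b >>; rewrite tensUU; split => //.
    by apply/IH; apply: suppinU.
  exists 0, << (a, b) >>; split; [exact: t0| |by rewrite add0r].
  apply: span_gen; exists << a >>, << b >>; rewrite tensUU; split => //.
  by apply/pqsym_coradicalE; apply: suppinU.
apply: (iff_trans step); split=> h.
  move=> p hp; case: (eqVneq p dempty) => [->|p0]; first by rewrite dlength0.
  case ew: (tfactors p) => [|q w].
    by case/eqP: p0; rewrite -[LHS]tword_tfactors ew [LHS]big_nil.
  (* Split off the first factor q: it is non-empty, so the pair (q, rest) forces the rest to have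
     length at most n. *)
  have := irrword_tfactors p; rewrite ew => /andP[/andP[q0 hq] hw].
  have ep : p = dtens q (tword w) by rewrite -tword_cons -ew tword_tfactors.
  have := h (q, tword w); rewrite -mcoeff_neq0 mcoeff_pqsym_hcomul [(_, _).1]/= [(_, _).2]/=.
  rewrite -ep mcoeff_neq0 => /(_ hp)[hl|e]; last by rewrite e eqxx in q0.
  by rewrite ep dlength_dtens (dlength_irr q0 hq) add1n.
(* Conversely, a non-empty left leg uses up at least one of the n + 1 factors. *)
move=> y; rewrite -mcoeff_neq0 mcoeff_pqsym_hcomul mcoeff_neq0 => /h.
rewrite dlength_dtens; case: (eqVneq y.1 dempty) => [|a0 hle]; first by right.
left; rewrite -ltnS; apply: leq_trans hle; rewrite -[X in (X < _)%N]add0n ltn_add2r.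
by rewrite lt0n dlength_eq0.
Qed.

End Filtrations.

Theorem proposition5p1 (K : fieldType) :
  (hopf_filtration (ParSym K) (filt K Aset) /\
   hopf_filtration (ParSym K) (filt K Iset)) /\
  (hopf_filtration (ParQSym K) (filt K Aset) /\
   hopf_filtration (ParQSym K) (filt K Pset) /\
   hopf_filtration (ParQSym K) (filt K Iset)) /\
  (algebra_filtration (ParSym K) (filt K Pset) /\
   ~ coalgebra_filtration (ParSym K) (filt K Pset)) /\
  (forall n x, filt K Pset n x <-> coradical_filtration (ParQSym K) n x).
Proof.
split; [split|split; [split; [|split]|split; [split|]]].
- exact: psym_hopf_filtration Aset_additive.
- exact: psym_hopf_filtration Iset_additive.
- exact: pqsym_additive_filtration Aset_additive.
- exact: pqsym_Pset_filtration.
- exact: pqsym_additive_filtration Iset_additive.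
- exact: psym_Pset_algebra.
- exact: psym_Pset_not_coalgebra.
- move=> n x; apply: (iff_trans (filt_PsetE n x)).
  exact: iff_sym (pqsym_coradical_filtrationE n x).
Qed.
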